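(* Let $q$ be a power of a prime $p$, $K$ the algebraic closure of $\mathbb{F}_q$, and let $m\geq 2$, $r\geq 2$ be integers with $p\nmid m$. Let $\alpha_1,\dots,\alpha_r\in K$ be pairwise distinct, let $\lambda_1,\dots,\lambda_r$ be integers with $1\leq \lambda_i<m$, put $\lambda_0:=\sum_{i=1}^r\lambda_i$, and assume $\gcd(m,\lambda_0)=1$. Let $\mathcal{X}$ be the curve over $K$ defined by $y^m=\prod_{i=1}^r (x-\alpha_i)^{\lambda_i}$ and let $Q_\infty$ be its only place at infinity. Suppose that $\gcd(m,\lambda_j)=1$ for each $j=1,\dots,r$. Then the following statements are equivalent: (i) $H(Q_\infty)=\langle m,r\rangle$; (ii) $\lambda_1=\lambda_2=\cdots=\lambda_r$. If in addition $r<m$, then these statements are also equivalent to: (iii) $H(Q_\infty)$ is symmetric.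
   Context: $\mathcal{X}$ denotes the nonsingular projective irreducible curve over $K$ with function field $K(\mathcal{X})=K(x,y)$ given by the affine equation; $Q_\infty$ is the unique place of $K(\mathcal{X})$ lying over the pole of $x$ in $K(x)$. For a place $Q$, the Weierstrass semigroup is $H(Q):=\{s\in\mathbb{N}_0 : (z)_\infty=sQ \text{ for some } z\in K(\mathcal{X})\}$, where $(z)_\infty$ is the pole divisor of $z$. The gap set is $G(Q):=\mathbb{N}\setminus H(Q)$; it has exactly $g(\mathcal{X})$ elements, where $g(\mathcal{X})$ is the genus. The Frobenius number $F_{H(Q)}$ is the largest element of $G(Q)$, and $H(Q)$ is called symmetric if $F_{H(Q)}=2g(\mathcal{X})-1$. The notation $\langle a_1,\dots,a_d\rangle$ means $\{t_1a_1+\cdots+t_da_d : t_1,\dots,t_d\in\mathbb{N}_0\}$. *)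

(* Defs.v *)
From HB Require Import structures.
From mathcomp Require Import all_boot all_order all_algebra all_field.
From mathcomp Require Import boolp classical_sets constructive_ereal.
From mathcomp Require Import freeg.

Set Implicit Arguments.
Unset Strict Implicit.
Unset Printing Implicit Defensive.

Import Order.TTheory GRing.Theory Num.Theory.
Local Open Scope ring_scope.

Section Places.
Variables (K L : fieldType) (iota : {rmorphism K -> L}).

(* A place of L over the constants iota(K), encoded by its normalized discrete
   valuation L -> Z u {oo}.  The value -oo of \bar int is never taken: it would
   contradict v 1 = 0 through the product rule. *)
Record place := Place {
  place_val :> L -> \bar int;
  place_val_eqy : forall z, place_val z = +oo%E <-> z = 0;
  place_valM : forall z w, place_val (z * w) = (place_val z + place_val w)%E;
  place_valD : forall z w,
    (Order.min (place_val z) (place_val w) <= place_val (z + w))%E;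
  place_val_normalized : exists z, place_val z = 1%:E;
  place_val_const : forall c : K, c != 0 -> place_val (iota c) = 0%E
}.

HB.instance Definition _ := gen_eqMixin place.
HB.instance Definition _ := gen_choiceMixin place.

Definition divisor := {freeg place}.

(* At z = 0 this is the zero divisor, since v_P 0 = +oo. *)
Definition is_pole_divisor (z : L) (D : divisor) : Prop :=
  forall P : place, (coeff P D)%:E = Order.max 0%E (- P z)%E.

Definition weierstrass_semigroup (Q : place) : set nat :=
  [set s | exists z : L, is_pole_divisor z [freeg [:: (s%:Z, Q)]]].

(* The zero function is included, since v_P 0 = +oo. *)
Definition RR_space (D : divisor) : set L :=
  [set z | forall P : place, ((- coeff P D)%:E <= P z)%E].

Definition is_basis_family (V : set L) (n : nat) (b : 'I_n -> L) : Prop :=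
  (forall i, V (b i)) /\
  (forall z, V z -> exists! c : {ffun 'I_n -> K},
     z = \sum_i iota (c i) * b i).

Definition has_dim (V : set L) (n : nat) : Prop :=
  exists b : 'I_n -> L, is_basis_family V b.

End Places.

(* [deg] is the sum of the coefficients; this is the degree of a divisor because
   K is algebraically closed, so that every place has degree one. *)
Definition is_genus (K : closedFieldType) (L : fieldType)
    (iota : {rmorphism K -> L}) (g : nat) : Prop :=
  (exists (D : divisor iota) (l : nat),
     has_dim iota (RR_space D) l /\ deg D - l%:Z + 1 = g%:Z) /\
  (forall (D : divisor iota) (l : nat),
     has_dim iota (RR_space D) l -> deg D - l%:Z + 1 <= g%:Z).

Definition is_frobenius_number (H : set nat) (f : nat) : Prop :=
  ~ H f /\ (forall s, ~ H s -> (s <= f)%N).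

(* When there are no gaps (genus 0) there is no Frobenius number here, and
   symmetry is false; the convention F = -1 is not used. *)
Definition symmetric_semigroup (K : closedFieldType) (L : fieldType)
    (iota : {rmorphism K -> L}) (Q : place iota) : Prop :=
  exists g f : nat,
    [/\ is_genus iota g,
        is_frobenius_number (weierstrass_semigroup Q) f
      & f%:Z = 2%:Z * g%:Z - 1].

Definition generated_semigroup (a : seq nat) : set nat :=
  [set n | exists t : 'I_(size a) -> nat,
     n = (\sum_i t i * nth 0%N a i)%N].

Notation ratfun K := {fraction {poly K}}.

Definition ratfunX (K : fieldType) : ratfun K := tofrac 'X.

Definition const_ratfun (K : fieldType) : {rmorphism K -> ratfun K} :=
  (@tofrac {poly K}) \o (@polyC K).

Definition const_ext (K : fieldType) (F : fieldExtType (ratfun K)) :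
    {rmorphism K -> F} :=
  in_alg F \o (@tofrac {poly K}) \o (@polyC K).

(* P' | P : the maximal ideal of P is contained in that of P'. *)
Definition lies_over (K : fieldType) (F : fieldExtType (ratfun K))
    (P' : place (const_ext F)) (P : place (const_ratfun K)) : Prop :=
  forall u : ratfun K, (0 < P u)%E -> (0 < P' u%:A)%E.

(* F = K(x, y) with y^m = prod_i (x - alpha_i)^lambda_i, where x is the
   variable of the rational function field underlying F. *)
Definition curve_function_field (K : fieldType) (m r : nat)
    (alpha : 'I_r -> K) (lambda : 'I_r -> nat)
    (F : fieldExtType (ratfun K)) (y : F) : Prop :=
  <<1; y>>%VS = fullv /\
  y ^+ m = (tofrac (\prod_i ('X - (alpha i)%:P) ^+ lambda i))%:A.

(* Main.v *)
Require Import Defs.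
From HB Require Import structures.
From mathcomp Require Import all_boot all_order all_algebra all_field.
From mathcomp Require Import boolp classical_sets constructive_ereal.
From mathcomp Require Import freeg generic_quotient.
From mathcomp Require Import zify ring.

Set Implicit Arguments.
Unset Strict Implicit.
Unset Printing Implicit Defensive.

Import Order.TTheory GRing.Theory Num.Theory.
Local Open Scope ring_scope.

(* Let f = prod_i (x - alpha_i)^lambda_i.  The functions
     e_j = y^j / prod_i (x - alpha_i)^floor(j lambda_i / m)   (0 <= j < m)
   form a K[x]-basis of the ring of functions regular outside Qinf, and the pole
   order of e_j at Qinf is d_j = sum_i (j lambda_i mod m), where the d_j represent
   all residues modulo m.  Hence H(Qinf) consists of the d_j + m t, and the count of
   such integers together with Riemann's inequality gives 2 g = (r - 1)(m - 1).
   For j > 0 each of the r terms of d_j lies between 1 and m - 1.  If H(Qinf) =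
   <m, r>, then d_j = r for some j, so all terms are 1; if 2 g - 1 = r (m - 1) - m
   is a gap, then d_j = r (m - 1) for some j, so all terms are m - 1.  In both cases
   j lambda_i mod m does not depend on i, and neither does lambda_i.  Conversely, for
   constant lambda, d_j = r (j lambda mod m) runs over the multiples r k, k < m.

   Places over a point x = c are obtained from the nonsingular points (c, b) of plane
   models w^m = h(x), and they are determined by the residues of x and w. *)

(** * Valuations *)

(** Places are bare normalized valuations, so none over a finite point is available at the outset,
    yet they are indispensable twice. A combination of the e_j with constant coefficients that
    vanishes to the order of x - c at all places over c must be shown trivial; this strips the
    denominators of functions regular outside Qinf of one factor x - c at a time. Moreover,
    Riemann's inequality is wanted for every divisor D: D is enlarged to a divisor of degree n whose
    space contains a copy of that of n Qinf, and each added place raises the dimension by at most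
    one because its residue field is K. Both steps require the places over c with their residue
    fields, hence the explicit construction from local rings. The condition gcd(m, lambda_i) = 1
    makes alpha_i totally ramified, with a single place, and gcd(m, lambda_0) = 1 does the same at
    infinity. The genus (r - 1)(m - 1)/2 does not depend on lambda, so symmetry prescribes the value
    of the largest gap. *)

Section Valuation.
Variables (K L : fieldType) (iota : {rmorphism K -> L}) (P : place iota).
Implicit Types (z w : L) (k l : K) (n : int).

(** The value at 0 is the default 0, hence the nonvanishing conditions below. *)
Definition ordv z : int := fine (P z).

Lemma place0 : P 0 = +oo%E.
Proof. exact/place_val_eqy. Qed.

Lemma place1 : P 1 = 0%E.
Proof. by rewrite -(rmorph1 iota) place_val_const ?oner_neq0. Qed.

Lemma place_fin z : z != 0 -> P z = (ordv z)%:E.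
Proof.
move=> z0; rewrite /ordv; case Pz : (P z) => [v| |] //.
- by move/place_val_eqy: Pz z0 => ->; rewrite eqxx.
- have := place_valM P z z^-1.
  by rewrite divff // place1 Pz.
Qed.

Lemma ordvM z w : z != 0 -> w != 0 -> ordv (z * w) = ordv z + ordv w.
Proof.
move=> z0 w0; have zw0 : z * w != 0 by rewrite mulf_neq0.
apply: EFin_inj; rewrite EFinD -!place_fin //; exact: place_valM.
Qed.

Lemma ordv1 : ordv 1 = 0.
Proof. by rewrite /ordv place1. Qed.

Lemma ordvV z : z != 0 -> ordv z^-1 = - ordv z.
Proof.
move=> z0; have := ordvM z0 (invr_neq0 z0).
by rewrite divff // ordv1; lia.
Qed.

Lemma ordvX z i : z != 0 -> ordv (z ^+ i) = ordv z *+ i.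
Proof.
move=> z0; elim: i => [|i IH]; first by rewrite expr0 ordv1.
by rewrite exprS ordvM ?expf_neq0 // IH mulrS.
Qed.

Lemma ordvXz z n : z != 0 -> ordv (z ^ n) = ordv z * n.
Proof.
move=> z0; case: n => i; first by rewrite -exprnP ordvX // -mulr_natr; lia.
by rewrite NegzE -exprnN ordvV ?expf_neq0 // ordvX // -mulr_natr; lia.
Qed.

Lemma ordvC k : k != 0 -> ordv (iota k) = 0.
Proof. by move=> k0; rewrite /ordv place_val_const. Qed.

Lemma placeC_ge0 k : (0 <= P (iota k))%E.
Proof.
have [->|k0] := eqVneq k 0; first by rewrite rmorph0 place0.
by rewrite place_val_const.
Qed.

Lemma placeN z : P (- z) = P z.
Proof.
rewrite -mulN1r -(rmorph1 iota) -rmorphN place_valM place_val_const ?add0e //.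
by rewrite oppr_eq0 oner_neq0.
Qed.

Lemma placeD_ge (a : \bar int) z w : (a <= P z)%E -> (a <= P w)%E -> (a <= P (z + w)%R)%E.
Proof.
move=> az aw; apply: le_trans (place_valD P z w).
by rewrite le_min az.
Qed.

Lemma placeD_gt (a : \bar int) z w : (a < P z)%E -> (a < P w)%E -> (a < P (z + w)%R)%E.
Proof.
move=> az aw; apply: lt_le_trans (place_valD P z w).
by rewrite lt_min az.
Qed.

Lemma placeD_lt z w : (P z < P w)%E -> P (z + w) = P z.
Proof.
move=> lt_zw; apply/le_anti/andP; split; last first.
  by apply: placeD_ge => //; exact: ltW.
rewrite leNgt; apply/negP => lt_zzw.
have : (P z < P ((z + w) + - w)%R)%E by apply: placeD_gt; rewrite ?placeN.
by rewrite addrK ltxx.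
Qed.

Lemma place_sum_ge (I : Type) (s : seq I) (Q : pred I) (f : I -> L) a :
  (forall i, Q i -> a <= P (f i))%E ->
  (a <= P (\sum_(i <- s | Q i) f i)%R)%E.
Proof.
move=> af; elim/big_ind: _ => //; first by rewrite place0 leey.
by move=> z w; exact: placeD_ge.
Qed.

Lemma place_sum_gt (I : Type) (s : seq I) (Q : pred I) (f : I -> L) a :
  a != +oo%E -> (forall i, Q i -> a < P (f i))%E ->
  (a < P (\sum_(i <- s | Q i) f i)%R)%E.
Proof.
move=> ay af; elim/big_ind: _ => //; first by rewrite place0 ltey.
by move=> z w; exact: placeD_gt.
Qed.

(** No two nonzero terms tie, so the strict triangle inequality isolates the one of least value; the
    independence arguments at totally ramified places rest on this. *)
Lemma place_sum_distinct (I : finType) (f : I -> L) :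
  (forall i j, f i != 0 -> f j != 0 -> P (f i) = P (f j) -> i = j) ->
  (exists i, f i != 0) ->
  exists i0, [/\ f i0 != 0, P (\sum_i f i) = P (f i0)
               & forall i, (P (f i0) <= P (f i))%E].
Proof.
move=> f_inj [i1 fi1].
case: (@arg_minP _ _ _ i1 predT (fun i => P (f i)) isT) => i0 _ i0_min.
have fi0 : f i0 != 0.
  apply/eqP => fi0; have := i0_min i1 isT.
  by rewrite fi0 place0 leye_eq => /eqP /place_val_eqy /eqP; apply/negP.
exists i0; split=> // [|i]; last exact: i0_min.
rewrite (bigD1 i0) //=; apply/placeD_lt/place_sum_gt.
  by rewrite place_fin.
move=> i i_i0; rewrite lt_neqAle i0_min // andbT.
have [->|fi] := eqVneq (f i) 0; first by rewrite place0 place_fin.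
by apply: contra i_i0 => /eqP /f_inj ->.
Qed.

Lemma placeM_ge0 z w : (0 <= P z)%E -> (0 <= P w)%E -> (0 <= P (z * w)%R)%E.
Proof. by move=> z0 w0; rewrite place_valM adde_ge0. Qed.

Lemma placeM_gt0 z w : (0 < P z)%E -> (0 <= P w)%E -> (0 < P (z * w)%R)%E.
Proof.
move=> z0 w0; rewrite place_valM; apply: lt_le_trans z0 _.
exact: leeDl.
Qed.

Lemma placeX_ge0 z i : (0 <= P z)%E -> (0 <= P (z ^+ i)%R)%E.
Proof.
move=> z0; elim: i => [|i IH]; first by rewrite expr0 place1.
by rewrite exprS placeM_ge0.
Qed.

Lemma place_root_ge0 z i : (0 < i)%N -> (0 <= P (z ^+ i)%R)%E -> (0 <= P z)%E.
Proof.
move=> i0; have [->|z0] := eqVneq z 0; first by rewrite place0.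
rewrite !place_fin ?expf_neq0 // ordvX // !lee_fin.
by rewrite pmulrn_lge0.
Qed.

Lemma place_root_gt0 z i : (0 < i)%N -> (0 < P (z ^+ i)%R)%E -> (0 < P z)%E.
Proof.
move=> i0; have [->|z0] := eqVneq z 0; first by rewrite place0.
rewrite !place_fin ?expf_neq0 // ordvX // !lte_fin.
by rewrite pmulrn_lgt0.
Qed.

Lemma placeV_eq0 z : P z = 0%E -> P z^-1 = 0%E.
Proof.
have [->|z0] := eqVneq z 0; first by rewrite place0.
by rewrite !place_fin ?invr_neq0 // ordvV // => -[->]; rewrite oppr0.
Qed.

Lemma placeM_eq0 z w : P z = 0%E -> P w = 0%E -> P (z * w) = 0%E.
Proof. by move=> z0 w0; rewrite place_valM z0 w0 adde0. Qed.

(** A relation rather than a residue map: for an arbitrary place it is not known beforehand that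
    every residue lies in K. *)
Definition has_residue z k : Prop := (0 < P (z - iota k)%R)%E.

Lemma has_residue_ge0 z k : has_residue z k -> (0 <= P z)%E.
Proof.
move=> zk; rewrite -(subrK (iota k) z); apply: placeD_ge (placeC_ge0 k).
exact: ltW.
Qed.

Lemma has_residueC k : has_residue (iota k) k.
Proof. by rewrite /has_residue subrr place0. Qed.

Lemma has_residueD z w k l :
  has_residue z k -> has_residue w l -> has_residue (z + w) (k + l).
Proof.
by move=> zk wl; rewrite /has_residue rmorphD opprD addrACA; exact: placeD_gt.
Qed.

Lemma has_residueM z w k l :
  has_residue z k -> has_residue w l -> has_residue (z * w) (k * l).
Proof.
move=> zk wl; rewrite /has_residue rmorphM.
have -> : z * w - iota k * iota l
        = (z - iota k) * w + (w - iota l) * iota k by ring.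
by apply: placeD_gt; apply: placeM_gt0;
  rewrite ?placeC_ge0 ?(has_residue_ge0 wl).
Qed.

Lemma has_residueX z k i : has_residue z k -> has_residue (z ^+ i) (k ^+ i).
Proof.
move=> zk; elim: i => [|i IH].
  by rewrite !expr0 -[X in has_residue X _](rmorph1 iota); exact: has_residueC.
by rewrite !exprS; exact: has_residueM.
Qed.

Lemma has_residue_sum (I : Type) (s : seq I) (Q : pred I) f g :
  (forall i, Q i -> has_residue (f i) (g i)) ->
  has_residue (\sum_(i <- s | Q i) f i) (\sum_(i <- s | Q i) g i).
Proof.
move=> fg; elim/big_ind2: _ => //.
  by rewrite -[X in has_residue X _](rmorph0 iota); exact: has_residueC.
by move=> z k w l; exact: has_residueD.
Qed.

Lemma has_residue_neq0 z k : has_residue z k -> k != 0 -> P z = 0%E.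
Proof.
move=> zk k0; rewrite -(subrK (iota k) z) addrC.
by rewrite placeD_lt place_val_const.
Qed.

Lemma has_residue0 z : has_residue z 0 = (0 < P z)%E.
Proof. by rewrite /has_residue rmorph0 subr0. Qed.

Lemma has_residue_inj z k l : has_residue z k -> has_residue z l -> k = l.
Proof.
move=> zk zl; apply/eqP; rewrite -subr_eq0; apply/negPn/negP => kl.
have : has_residue (z + iota (-1) * z) (k + (-1) * l).
  by apply: has_residueD => //; apply: has_residueM => //; exact: has_residueC.
rewrite rmorphN rmorph1 !mulN1r subrr => /has_residue_neq0.
by rewrite place0 => /(_ kl).
Qed.

Lemma has_residueV z k : has_residue z k -> k != 0 -> has_residue z^-1 k^-1.
Proof.
move=> zk k0; have z0 : z != 0.
  by apply/eqP => z0; have := has_residue_neq0 zk k0; rewrite z0 place0.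
rewrite /has_residue fmorphV.
have ik0 : iota k != 0 by rewrite fmorph_eq0.
have -> : z^-1 - (iota k)^-1 = (z - iota k) * (- (z^-1 * (iota k)^-1)).
  by field; apply/andP.
apply: placeM_gt0 => //; rewrite placeN place_valM.
by rewrite (placeV_eq0 (has_residue_neq0 zk k0)) add0e -fmorphV placeC_ge0.
Qed.

End Valuation.

Lemma place_ext (K L : fieldType) (iota : {rmorphism K -> L}) (P Q : place iota) :
  (forall z, z != 0 -> P z = Q z) -> P = Q.
Proof.
move=> PQ; have {PQ} : place_val P = place_val Q.
  apply/funext => z; have [->|/PQ //] := eqVneq z 0; by rewrite !place0.
case: P Q => [v v1 v2 v3 v4 v5] [w w1 w2 w3 w4 w5] /= vw.
by subst w; congr Place; exact: Prop_irrelevance.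
Qed.

(* [Rel z k] should hold when z lies in the local ring and has residue k, and [t]
   should be a uniformizer; the place is then t^n u |-> n for units u. *)
Section PlaceOfResidues.
Variables (K L : fieldType) (iota : {rmorphism K -> L}).
Variables (Rel : L -> K -> Prop) (t : L).
Hypotheses (Rel0 : forall k, Rel 0 k -> k = 0)
  (RelD : forall z w k l, Rel z k -> Rel w l -> Rel (z + w) (k + l))
  (RelM : forall z w k l, Rel z k -> Rel w l -> Rel (z * w) (k * l))
  (RelC : forall k, Rel (iota k) k)
  (t_neq0 : t != 0) (Relt : Rel t 0)
  (Rel_dec : forall z, z != 0 ->
     exists n : int, exists u k, [/\ z = t ^ n * u, Rel u k & k != 0]).

Let Rel_inj z k l : Rel z k -> Rel z l -> k = l.
Proof.
move=> zk zl; have := RelD zk (RelM (RelC (-1)) zl).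
rewrite rmorphN rmorph1 !mulN1r subrr => /Rel0 /eqP.
by rewrite subr_eq0 => /eqP.
Qed.

Let RelX i : (0 < i)%N -> Rel (t ^+ i) 0.
Proof.
case: i => // i _; elim: i => [|i IH]; first by rewrite expr1.
by rewrite exprS -(mulr0 0); exact: RelM.
Qed.

Let tX_neq0 n : t ^ n != 0.
Proof. by rewrite expfz_neq0. Qed.

Let dec_neq0 z n u k : z = t ^ n * u -> Rel u k -> k != 0 -> z != 0.
Proof.
move=> -> uk k0; rewrite mulf_neq0 //; apply: contraNneq k0 => u0.
by rewrite u0 in uk; apply/eqP/Rel0.
Qed.

(** For n > 0 the factor t^n forces the residue of z to be 0; for n < 0 the same argument applied to
    u = t^(-n) z contradicts l != 0. *)
Let Rel_ge0 z k n u l :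
  Rel z k -> z = t ^ n * u -> Rel u l -> l != 0 -> 0 <= n /\ (k != 0 -> n = 0).
Proof.
move=> zk def_z ul l0.
have ut : u = t ^ (- n) * z.
  by rewrite def_z mulrA -expfzDr // addNr expr0z mul1r.
have [n0|n0] := leP 0 n.
  split=> // k0; apply/eqP; apply: contraNT k0 => n_neq0.
  have ni : n = Posz `|n| by lia.
  rewrite ni -exprnP in def_z.
  have := RelM (RelX (_ : (0 < `|n|)%N)) ul; rewrite mul0r -def_z.
  by move=> /(_ ltac:(lia)) /(Rel_inj zk) ->.
case/negP: l0; have ni : - n = Posz `|n| by lia.
rewrite ni -exprnP in ut.
have := RelM (RelX (_ : (0 < `|n|)%N)) zk; rewrite mul0r -ut.
by move=> /(_ ltac:(lia)) /(Rel_inj ul) ->.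
Qed.

Let dec_inj n1 u1 k1 n2 u2 k2 :
  t ^ n1 * u1 = t ^ n2 * u2 -> Rel u1 k1 -> Rel u2 k2 -> k1 != 0 -> k2 != 0 ->
  n1 = n2.
Proof.
move=> e12 uk1 uk2 k10 k20.
have e1 : u1 = t ^ (n2 - n1) * u2.
  by rewrite addrC expfzDr // -mulrA -e12 mulrA -expfzDr // addNr expr0z mul1r.
have [_ /(_ k10)] := Rel_ge0 uk1 e1 uk2 k20.
by move/eqP; rewrite subr_eq0 => /eqP.
Qed.

Let w z : \bar int :=
  if pselect (z != 0) is left z0 then (projT1 (cid (Rel_dec z0)))%:E else +oo%E.

Let w_dec z n u k : z = t ^ n * u -> Rel u k -> k != 0 -> w z = n%:E.
Proof.
move=> def_z uk k0; rewrite /w; case: pselect => [z0|]; last first.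
  by case; exact: dec_neq0 def_z uk k0.
case: cid => n' /= [u' [k' [def_z' uk' k0']]]; congr (_%:E).
by apply: dec_inj uk' uk k0' k0; rewrite -def_z -def_z'.
Qed.

Let w_eqy z : w z = +oo%E <-> z = 0.
Proof.
rewrite /w; case: pselect => [z0|/negP]; last by rewrite negbK => /eqP.
by split=> // /eqP; rewrite (negPf z0).
Qed.

Let w_M x y : w (x * y) = (w x + w y)%E.
Proof.
have w0 : w 0 = +oo%E by apply/w_eqy.
have wN z : w z != -oo%E by rewrite /w; case: pselect.
have [->|/Rel_dec [n [u [k [ex uk k0]]]]] := eqVneq x 0.
  by rewrite mul0r w0 addye.
have [->|/Rel_dec [n' [u' [k' [ey uk' k0']]]]] := eqVneq y 0.
  by rewrite mulr0 w0 addey.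
rewrite (w_dec ex uk k0) (w_dec ey uk' k0') -EFinD.
apply: (@w_dec _ _ (u * u') (k * k')); last by rewrite mulf_neq0.
  by rewrite ex ey expfzDr //; ring.
exact: RelM.
Qed.

Let w_ge0 z k : Rel z k -> (0 <= w z)%E.
Proof.
move=> zk; have [->|/Rel_dec [n [u [l [ex ul l0]]]]] := eqVneq z 0.
  by have /w_eqy -> : 0 = 0 :> L by [].
rewrite (w_dec ex ul l0) lee_fin.
by case: (Rel_ge0 zk ex ul l0).
Qed.

Let w_gt0 z : Rel z 0 -> (0 < w z)%E.
Proof.
move=> zk; have [->|/Rel_dec [n [u [l [ex ul l0]]]]] := eqVneq z 0.
  by have /w_eqy -> : 0 = 0 :> L by [].
rewrite (w_dec ex ul l0) lte_fin.
case: (Rel_ge0 zk ex ul l0); rewrite le_eqVlt => /orP[/eqP n0 _|//].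
have uz : u = z by rewrite ex -n0 expr0z mul1r.
by rewrite uz in ul; case/eqP: l0; exact: Rel_inj ul zk.
Qed.

Let w_D x y : (Order.min (w x) (w y) <= w (x + y)%R)%E.
Proof.
wlog : x y / (w x <= w y)%E.
  move=> IH; have /orP[|yx] := le_total (w x) (w y); first exact: IH.
  by rewrite minC addrC; exact: IH.
move=> xy; rewrite min_l //.
have [x0|/Rel_dec [n [u [k [ex uk k0]]]]] := eqVneq x 0.
  by rewrite x0 add0r -x0.
have [y0|/Rel_dec [n' [u' [k' [ey uk' k0']]]]] := eqVneq y 0.
  by rewrite y0 addr0.
move: xy; rewrite (w_dec ex uk k0) (w_dec ey uk' k0') lee_fin => nn'.
(* The second summand in x + y = t^n (u + t^(n' - n) u') has residue k' if n = n' and 0 otherwise,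
   so the bracket lies in the local ring. *)
have [l Rl] : exists l, Rel (t ^ (n' - n) * u') l.
  have [e|e] := eqVneq n n'; first by exists k'; rewrite e subrr expr0z mul1r.
  have -> : n' - n = Posz `|n' - n| by lia.
  exists (0 * k'); apply: RelM => //.
  by rewrite -exprnP; apply: RelX; lia.
have -> : x + y = t ^ n * (u + t ^ (n' - n) * u').
  by rewrite mulrDr mulrA -expfzDr // subrKC -ex -ey.
rewrite w_M.
have -> : w (t ^ n) = n%:E.
  apply: (@w_dec _ _ 1 1); rewrite ?mulr1 ?oner_neq0 //.
  by rewrite -[X in Rel X _](rmorph1 iota).
by apply: leeDl; exact: w_ge0 (RelD uk Rl).
Qed.

Let w_norm : exists z, w z = 1%:E.
Proof.
exists t; apply: (@w_dec _ _ 1 1); rewrite ?mulr1 ?expr1z ?oner_neq0 //.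
by rewrite -[X in Rel X _](rmorph1 iota).
Qed.

Let w_const c : c != 0 -> w (iota c) = 0%E.
Proof. by move=> c0; apply: (@w_dec _ _ (iota c) c); rewrite ?expr0z ?mul1r. Qed.

(** The third conclusion, residue field K, later bounds the growth of Riemann-Roch spaces. *)
Lemma place_of_residues : exists P : place iota,
  [/\ P t = 1%:E, forall z k, Rel z k -> has_residue P z k
    & forall z, (0 <= P z)%E -> exists k, has_residue P z k].
Proof.
pose P := Place w_eqy w_M w_D w_norm w_const.
have Rel_res z k : Rel z k -> has_residue P z k.
  move=> zk; apply: w_gt0; rewrite -(subrr k) -rmorphN.
  exact: RelD.
exists P; split=> //.
  apply: (@w_dec _ _ 1 1); rewrite ?mulr1 ?expr1z ?oner_neq0 //.
  by rewrite -[X in Rel X _](rmorph1 iota).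
move=> z; have [->|/Rel_dec [n [u [k [ex uk k0]]]]] := eqVneq z 0.
  by move=> _; exists 0; rewrite has_residue0 place0.
rewrite /= (w_dec ex uk k0) lee_fin le_eqVlt => /orP[/eqP n0|n0].
  by exists k; apply: Rel_res; rewrite ex -n0 expr0z mul1r.
by exists 0; rewrite has_residue0 /= (w_dec ex uk k0).
Qed.

End PlaceOfResidues.

(** * Places at nonsingular points of plane models *)

Section PlanePoint.
Variables (K : fieldType) (F : fieldExtType (ratfun K)).

Definition evalx : {rmorphism {poly K} -> F} := in_alg F \o @tofrac {poly K}.

Lemma evalxC k : evalx k%:P = const_ext F k. Proof. by []. Qed.

Lemma evalx_eq0 p : (evalx p == 0) = (p == 0).
Proof. by rewrite /evalx /= scaler_eq0 oner_eq0 orbF tofrac_eq0. Qed.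

Lemma place_evalx_ge0 (P : place (const_ext F)) c p :
  (0 <= P (evalx ('X - c%:P))%R)%E -> (0 <= P (evalx p))%E.
Proof.
move=> xc; have x0 : (0 <= P (evalx 'X)%R)%E.
  rewrite -(subrK c%:P 'X) rmorphD; apply: placeD_ge => //; exact: placeC_ge0.
rewrite -[p]coefK poly_def rmorph_sum; apply: place_sum_ge => // i _.
rewrite -mul_polyC rmorphM rmorphXn; apply: placeM_ge0; first exact: placeC_ge0.
exact: placeX_ge0.
Qed.

Lemma evalx_residue (P : place (const_ext F)) c p :
  (0 < P (evalx ('X - c%:P))%R)%E -> has_residue P (evalx p) p.[c].
Proof.
move=> xc; have /factor_theorem[q pq] : root (p - p.[c]%:P) c.
  by rewrite /root hornerD hornerN hornerC subrr.
rewrite /has_residue -evalxC -rmorphB pq mulrC rmorphM.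
by apply: placeM_gt0 => //; apply/(@place_evalx_ge0 _ c)/ltW.
Qed.

Variable w : F.

(** The outer variable stands for w and the inner one for x; the image is the coordinate ring
    K[x, w] of the plane model. *)
Definition eval2 : {rmorphism {poly {poly K}} -> F} :=
  horner_eval w \o map_poly evalx.

Lemma eval2E P : eval2 P = (map_poly evalx P).[w]. Proof. by []. Qed.

Lemma eval2C p : eval2 p%:P = evalx p.
Proof. by rewrite /eval2 /= map_polyC /horner_eval hornerC. Qed.

Lemma eval2X : eval2 'X = w.
Proof. by rewrite /eval2 /= map_polyX /horner_eval hornerX. Qed.

Variables c b : K.

Definition eval_at : {rmorphism {poly {poly K}} -> K} :=
  horner_eval c \o horner_eval b%:P.

Lemma eval_atC p : eval_at p%:P = p.[c].
Proof. by rewrite /eval_at /= /horner_eval hornerC. Qed.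

Lemma eval_atX : eval_at 'X = b.
Proof. by rewrite /eval_at /= /horner_eval hornerX hornerC. Qed.

Lemma eval_at_ideal P :
  exists Q q, P = Q * ('X - b%:P%:P) + q%:P * ('X - c%:P)%:P + (eval_at P)%:P%:P.
Proof.
have /factor_theorem[Q PQ] : root (P - P.[b%:P]%:P) b%:P.
  by rewrite /root hornerD hornerN hornerC subrr.
have /factor_theorem[q pq] : root (P.[b%:P] - (eval_at P)%:P) c.
  by rewrite /root hornerD hornerN hornerC subrr.
exists Q, q; rewrite -PQ -polyCM -pq polyCB; ring.
Qed.

Lemma eval2_residue (P : place (const_ext F)) A :
  (0 < P (evalx ('X - c%:P))%R)%E -> has_residue P w b ->
  has_residue P (eval2 A) (eval_at A).
Proof.
move=> xc wb; elim/poly_ind: A => [|A p IH].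
  by rewrite !rmorph0 has_residue0 place0.
rewrite !rmorphD !rmorphM eval2C eval_atC eval2X eval_atX.
by apply: has_residueD; [exact: has_residueM|exact: evalx_residue].
Qed.

(** The first condition places (c, b) on the model: every relation between x and w vanishes there.
    The second makes F its field of fractions, with denominators in K[x]. *)
Hypotheses
  (eval2_ker : forall P, eval2 P = 0 -> eval_at P = 0)
  (eval2_frac : forall z : F, exists h P, h != 0 /\ evalx h * z = eval2 P).
(* Nonsingularity at (c, b): up to the local unit S, the maximal ideal (x - c, w - b)
   is generated by T, and x - c has order a. *)
Variables (S T U V : {poly {poly K}}) (a : nat).
Hypotheses
  (S_neq0 : eval_at S != 0) (T_eq0 : eval_at T = 0) (U_neq0 : eval_at U != 0)
  (T_gen : eval2 T != 0) (a_gt0 : (0 < a)%N)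
  (def_x : eval2 S * evalx ('X - c%:P) = eval2 T ^+ a * eval2 U)
  (def_w : eval2 S * (w - const_ext F b) = eval2 T * eval2 V).

Let eval2_eq0 P : eval_at P != 0 -> eval2 P != 0.
Proof. by apply: contraNneq => /eval2_ker ->. Qed.

(** By [eval_at_ideal], A is a combination of w - b and x - c, and multiplication by S turns each
    into a multiple of T; [a_gt0] lets one factor T be split off from T^a. *)
Let eval2_div A : eval_at A = 0 -> exists B, eval2 S * eval2 A = eval2 T * eval2 B.
Proof.
move=> A0; have [Q [q ->]] := eval_at_ideal A; rewrite A0 !polyC0 addr0.
exists (Q * V + q%:P * T ^+ a.-1 * U).
rewrite !(rmorphD eval2, rmorphM, rmorphXn) !eval2C rmorphN -polyCN eval2C eval2X.
rewrite rmorphN evalxC.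
have -> u v s t x : s * (u * v + t * x) = u * (s * v) + t * (s * x) :> F by ring.
by rewrite def_w def_x -[in LHS](prednK a_gt0) exprS; ring.
Qed.

(** Division by T is repeated as long as the quotient vanishes at the point. It must stop: P divides
    a nonzero h in K[x], and if (x - c)^l exactly divides h, then h has order a l, so a l + 1
    divisions are impossible. *)
Let eval2_decomp P : eval2 P != 0 ->
  exists n A B, [/\ eval_at A != 0, eval_at B != 0
                 & eval2 A * eval2 P = eval2 T ^+ n * eval2 B].
Proof.
move=> P0.
set good := (exists n A B, _).
have step n : good \/ exists B, eval2 (S ^+ n) * eval2 P = eval2 T ^+ n * eval2 B.
  elim: n => [|n [|[B SB]]]; [|by left|].
    by right; exists P; rewrite !expr0 rmorph1.
  have [/eval2_div[C SC]|B0] := eqVneq (eval_at B) 0.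
    right; exists C; rewrite exprS rmorphM -mulrA SB mulrCA SC exprS; ring.
  by left; exists n, (S ^+ n), B; split=> //; rewrite rmorphXn expf_neq0.
have [h [P' [h0 def_h]]] := eval2_frac (eval2 P)^-1.
have {}def_h : evalx h = eval2 P * eval2 P' by rewrite -def_h mulrCA divff ?mulr1.
have [l [h1 h1c def_h1]] := multiplicity_XsubC h c; rewrite h0 /= in h1c.
have [//|[B]] := step (a * l).+1; rewrite rmorphXn => SB; exfalso.
(* The two expressions for h are compared after cancelling T^(a l): at the point the first is
   nonzero, while the second keeps a factor T. *)
have : eval2 (S ^+ (a * l).+1 * U ^+ l * h1%:P - S ^+ l * T * B * P') = 0.
  apply: (mulfI (expf_neq0 (a * l) T_gen)); rewrite mulr0.
  rewrite !(rmorphB, rmorphM, rmorphXn) eval2C.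
  apply/eqP; rewrite mulrBr subr_eq0; apply/eqP.
  transitivity (eval2 S ^+ l * (eval2 S ^+ (a * l).+1 * eval2 P) * eval2 P'); last first.
    by rewrite SB exprS; ring.
  transitivity (eval2 S ^+ l * eval2 S ^+ (a * l).+1 * evalx h); last first.
    by rewrite def_h; ring.
  rewrite def_h1 rmorphM rmorphXn.
  transitivity (eval2 S ^+ (a * l).+1 * evalx h1 * (eval2 S * evalx ('X - c%:P)) ^+ l).
    by rewrite def_x exprMn -exprM; ring.
  by rewrite exprMn; ring.
move/eval2_ker/eqP; rewrite !(rmorphB, rmorphM, rmorphXn) eval_atC T_eq0.
rewrite mulr0 !mul0r subr0.
by apply/negP; rewrite !mulf_neq0 ?expf_neq0.
Qed.

Let eval2_decomp_full z : z != 0 ->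
  exists (n : int) A B, [/\ eval_at A != 0, eval_at B != 0
                 & eval2 A * z = eval2 T ^ n * eval2 B].
Proof.
move=> z0; have [h [P [h0 hz]]] := eval2_frac z.
have h0' : eval2 h%:P != 0 by rewrite eval2C evalx_eq0.
have P0 : eval2 P != 0 by rewrite -hz -eval2C mulf_neq0.
have [n1 [A1 [B1 [A10 B10 e1]]]] := eval2_decomp P0.
have [n2 [A2 [B2 [A20 B20 e2]]]] := eval2_decomp h0'.
exists (n1%:Z - n2%:Z), (A1 * B2), (A2 * B1).
split; rewrite ?rmorphM ?mulf_neq0 //.
rewrite expfzDr // -exprnN -exprnP.
have Tn2 := expf_neq0 n2 T_gen; apply: (mulfI Tn2).
transitivity ((eval2 A2 * eval2 h%:P) * (eval2 A1 * z)); first by rewrite e2; ring.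
transitivity (eval2 A2 * (eval2 A1 * eval2 P)).
  by rewrite -hz -eval2C; ring.
by rewrite e1; field.
Qed.

Lemma plane_point : exists P : place (const_ext F),
  [/\ P (evalx ('X - c%:P)) = (a%:Z)%:E, has_residue P w b,
      forall z, (0 <= P z)%E -> exists k, has_residue P z k
    & forall Q : place (const_ext F),
        (0 < Q (evalx ('X - c%:P))%R)%E -> has_residue Q w b -> Q = P].
Proof.
(* The local ring of the point: z is a fraction B / A with A nonzero at (c, b), and k is its value
   there. *)
pose Rel z k := exists A B, [/\ eval_at A != 0, eval2 A * z = eval2 B
                             & k * eval_at A = eval_at B].
have Rel_eval B : Rel (eval2 B) (eval_at B).
  by exists 1, B; rewrite !rmorph1 oner_neq0 mul1r mulr1.
have Rel0 k : Rel 0 k -> k = 0.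
  move=> [A [B [A0 e1 e2]]]; apply/eqP; move: e1; rewrite mulr0 => /esym/eval2_ker.
  by rewrite -e2 => /eqP; rewrite mulf_eq0 (negPf A0) orbF.
have RelD z1 z2 k1 k2 : Rel z1 k1 -> Rel z2 k2 -> Rel (z1 + z2) (k1 + k2).
  move=> [A1 [B1 [A10 e1 f1]]] [A2 [B2 [A20 e2 f2]]].
  exists (A1 * A2), (B1 * A2 + A1 * B2).
  rewrite !rmorphD !rmorphM mulf_neq0 // -e1 -f1 -e2 -f2; split=> //; ring.
have RelM z1 z2 k1 k2 : Rel z1 k1 -> Rel z2 k2 -> Rel (z1 * z2) (k1 * k2).
  move=> [A1 [B1 [A10 e1 f1]]] [A2 [B2 [A20 e2 f2]]].
  exists (A1 * A2), (B1 * B2).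
  rewrite !rmorphM mulf_neq0 // -e1 -f1 -e2 -f2; split=> //; ring.
have RelC k : Rel (const_ext F k) k.
  by have := Rel_eval k%:P%:P; rewrite eval2C eval_atC hornerC.
have RelT : Rel (eval2 T) 0 by rewrite -T_eq0.
have Rel_dec z : z != 0 ->
    exists n : int, exists u k, [/\ z = eval2 T ^ n * u, Rel u k & k != 0].
  move=> /eval2_decomp_full[n [A [B [A0 B0 e]]]].
  exists n, (eval2 B / eval2 A), (eval_at B / eval_at A); split.
  - by rewrite mulrA -e mulrAC divff ?mul1r // eval2_eq0.
  - by exists A, B; rewrite mulrCA divff ?mulr1 ?eval2_eq0 // divfK.
  - by rewrite mulf_neq0 ?invr_neq0.
have [P [PT P_res P_K]] := place_of_residues Rel0 RelD RelM RelC T_gen RelT Rel_dec.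
have P_unit A : eval_at A != 0 -> P (eval2 A) = 0%E.
  by move=> A0; exact: (has_residue_neq0 (P_res _ _ (Rel_eval A)) A0).
exists P; split=> //.
- have := congr1 P def_x; rewrite !place_valM !P_unit // add0e adde0 => ->.
  rewrite place_fin ?expf_neq0 // ordvX //; congr (_%:E).
  by rewrite /ordv PT /= -[RHS]natz.
- by have := P_res _ _ (Rel_eval 'X); rewrite eval2X eval_atX.
move=> Q Qx Qw; have Q_res := eval2_residue _ Qx Qw.
have Q_unit A : eval_at A != 0 -> ordv Q (eval2 A) = 0.
  by move=> A0; rewrite /ordv (has_residue_neq0 (Q_res A) A0).
have P_unit' A : eval_at A != 0 -> ordv P (eval2 A) = 0.
  by move=> A0; rewrite /ordv P_unit.
(* Local units have order 0 at Q as well, so orders at Q are those at P times the order of T;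
   normalization of Q makes this factor 1. *)
have QP z : z != 0 -> ordv Q z = ordv P z * ordv Q (eval2 T).
  move=> z0; have [n [A [B [A0 B0 e]]]] := eval2_decomp_full z0.
  have ord_z (R : place (const_ext F)) :
      (forall C, eval_at C != 0 -> ordv R (eval2 C) = 0) ->
      ordv R z = ordv R (eval2 T) * n.
    move=> R0; have := congr1 (ordv R) e.
    rewrite ordvM ?eval2_eq0 // ordvM ?(expfz_neq0 _ T_gen) ?eval2_eq0 //.
    rewrite ordvXz //.
    by rewrite (R0 A) // (R0 B) // add0r addr0.
  by rewrite !ord_z // {2}/ordv PT mul1r mulrC.
have QT0 : 0 < ordv Q (eval2 T).
  have := Q_res T; rewrite T_eq0 has_residue0 place_fin //.
have QT1 : ordv Q (eval2 T) = 1.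
  have [z Qz] := place_val_normalized Q.
  have z0 : z != 0 by apply/eqP => z0; rewrite z0 place0 in Qz.
  have := QP z z0; rewrite {1}/ordv Qz /=; move: (ordv P z) (ordv Q _) QT0.
  move=> u v v0 uv; have u0 : 0 < u by nia.
  by apply/eqP; rewrite eq_le; apply/andP; split; nia.
by apply: place_ext => z z0; rewrite !place_fin // QP // QT1 mulr1.
Qed.

End PlanePoint.

Arguments evalx : simpl never.
Arguments eval2 : simpl never.
Arguments eval_at : simpl never.

(** * Points of the models w^m = h(x) *)

Section RadicalPoint.
Variables (K : fieldType) (F : fieldExtType (ratfun K)).
Variables (w : F) (h : {poly K}) (m : nat).
Hypotheses (m_gt0 : (0 < m)%N) (def_w : w ^+ m = evalx F h)
  (w_free : forall P : {poly {poly K}},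
     (size P <= m)%N -> eval2 w P = 0 -> P = 0)
  (w_gen : forall z : F, exists q P, q != 0 /\ evalx F q * z = eval2 w P).

(** Modulo W^m - h, which vanishes at (c, b), P reduces to degree less than m, where w satisfies no
    nontrivial relation. *)
Lemma radical_ker c b P : b ^+ m = h.[c] -> eval2 w P = 0 -> eval_at c b P = 0.
Proof.
move=> hc; have mon_D := monicXnsubC h m_gt0.
set D := 'X^m - h%:P in mon_D; rewrite (Pdiv.RingMonic.rdivp_eq mon_D P).
have D0 : eval2 w D = 0.
  by rewrite rmorphB rmorphXn eval2C eval2X def_w subrr.
rewrite rmorphD rmorphM D0 mulr0 add0r => /w_free ->.
  by rewrite addr0 rmorphM rmorphB rmorphXn eval_atC eval_atX hc subrr mulr0.
have := Pdiv.Ring.ltn_rmodpN0 P (monic_neq0 mon_D).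
by rewrite size_XnsubC.
Qed.

(** The uniformizer is x - c. With S = (w^m - b^m) / (w - b), of value m b^(m - 1) at the point, and
    h - h(c) = (x - c) q, one has S (w - b) = (x - c) q. *)
Lemma radical_unramified_point c b :
  b ^+ m = h.[c] -> b != 0 -> m%:R != 0 :> K ->
  exists P : place (const_ext F),
  [/\ P (evalx F ('X - c%:P)) = 1%:E, has_residue P w b,
      forall z, (0 <= P z)%E -> exists k, has_residue P z k
    & forall Q : place (const_ext F),
        (0 < Q (evalx F ('X - c%:P))%R)%E -> has_residue Q w b -> Q = P].
Proof.
move=> hc b0 mK.
pose S : {poly {poly K}} := \sum_(i < m) 'X^(m.-1 - i) * b%:P%:P ^+ i.
have /factor_theorem[q hq] : root (h - h.[c]%:P) c.
  by rewrite /root hornerD hornerN hornerC subrr.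
apply: (@plane_point _ F w c b (fun P => @radical_ker c b P hc) w_gen
          S ('X - c%:P)%:P S q%:P 1).
- rewrite rmorph_sum (eq_bigr (fun=> b ^+ m.-1)) => [|i _]; last first.
    rewrite rmorphM !rmorphXn eval_atC hornerC eval_atX -exprD subnK //.
    by rewrite -ltnS prednK.
  by rewrite sumr_const card_ord -mulr_natr mulf_neq0 ?expf_neq0.
- by rewrite eval_atC !hornerE subrr.
- rewrite rmorph_sum (eq_bigr (fun=> b ^+ m.-1)) => [|i _]; last first.
    rewrite rmorphM !rmorphXn eval_atC hornerC eval_atX -exprD subnK //.
    by rewrite -ltnS prednK.
  by rewrite sumr_const card_ord -mulr_natr mulf_neq0 ?expf_neq0.
- by rewrite eval2C evalx_eq0 polyXsubC_eq0.
- by [].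
- by rewrite eval2C expr1 mulrC.
- rewrite !eval2C -[RHS]rmorphM [X in _ = evalx F X]mulrC -hq rmorphB -def_w.
  rewrite -hc evalxC rmorphXn [LHS]mulrC.
  rewrite subrXX; congr (_ * _); rewrite rmorph_sum; apply: eq_bigr => i _.
  by rewrite rmorphM !rmorphXn eval2X eval2C.
Qed.

(** The uniformizer is w: s (x - c) = w^m with s nonzero at c, so x - c has order m. *)
Lemma radical_branch_point c s :
  h = ('X - c%:P) * s -> s.[c] != 0 ->
  exists P : place (const_ext F),
  [/\ P (evalx F ('X - c%:P)) = (m%:Z)%:E, has_residue P w 0,
      forall z, (0 <= P z)%E -> exists k, has_residue P z k
    & forall Q : place (const_ext F),
        (0 < Q (evalx F ('X - c%:P))%R)%E -> has_residue Q w 0 -> Q = P].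
Proof.
move=> hs sc; have hc : 0 ^+ m = h.[c].
  by rewrite expr0n gtn_eqF // hs !hornerE subrr mul0r.
have s0 : s != 0 by apply: contraNneq sc => ->; rewrite horner0.
apply: (@plane_point _ F w c 0 (fun P => @radical_ker c 0 P hc) w_gen
          s%:P 'X 1 s%:P m).
- by rewrite eval_atC.
- by rewrite eval_atX.
- by rewrite rmorph1 oner_neq0.
- rewrite eval2X; apply/eqP => w0; move: def_w; rewrite w0 expr0n gtn_eqF //.
  move/esym/eqP; rewrite evalx_eq0 hs mulf_eq0 polyXsubC_eq0.
  exact/negP.
- by [].
- by rewrite eval2X eval2C rmorph1 mulr1 def_w hs rmorphM mulrC.
- by rewrite eval2X !eval2C rmorph0 subr0 mulrC.
Qed.

End RadicalPoint.

(** * Degrees and orders at infinity *)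

Lemma fraction_clear_denom (R : idomainType) (u : {fraction R}) :
  exists n d : R, d != 0 /\ tofrac d * u = tofrac n.
Proof.
elim/quotW: u => u; exists (frac u).1, (frac u).2; split; first exact: denom_ratioP.
change (FracField.mul (FracField.tofrac (frac u).2) (\pi_(FracField.type R)%qT u)
        = FracField.tofrac (frac u).1).
rewrite !piE; apply/eqmodP.
rewrite /= FracField.equivfE /FracField.mulf.
by rewrite !numden_Ratio ?mulf_neq0 ?oner_eq0 ?denom_ratioP // mul1r mulr1.
Qed.

Lemma rmorph_roots_prod (R S : comNzRingType) (f : {rmorphism R -> S})
    (n : nat) (d : R) (bs : seq R) (z : S) :
  'X^n - d%:P = \prod_(b <- bs) ('X - b%:P) ->
  z ^+ n - f d = \prod_(b <- bs) (z - f b).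
Proof.
move=> /(congr1 (fun p => (map_poly f p).[z])) /=.
rewrite rmorphB rmorphXn rmorph_prod /= map_polyX map_polyC /= !hornerE => ->.
rewrite horner_prod; apply: eq_bigr => b _.
by rewrite rmorphB /= map_polyX map_polyC /= !hornerE.
Qed.

Section Degree.
Variable K : fieldType.
Implicit Types p q : {poly K}.

Definition degp p : nat := (size p).-1.

Lemma degpM p q : p != 0 -> q != 0 -> degp (p * q) = (degp p + degp q)%N.
Proof.
move=> p0 q0; rewrite /degp size_mul //.
by rewrite (polySpred p0) (polySpred q0) addSn addnS.
Qed.

Lemma degpX p n : degp (p ^+ n) = (degp p * n)%N.
Proof. exact: size_exp. Qed.

Lemma degp_XsubC c : degp ('X - c%:P) = 1%N.
Proof. by rewrite /degp size_XsubC. Qed.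

Lemma degp_prod (I : finType) (g : I -> {poly K}) :
  (forall i, g i != 0) -> degp (\prod_i g i) = (\sum_i degp (g i))%N.
Proof.
move=> g0; have [] : \prod_i g i != 0 /\ degp (\prod_i g i) = (\sum_i degp (g i))%N.
  elim/big_ind2: _ => [|p m q n [p0 <-] [q0 <-]|i _].
  - by rewrite oner_neq0 /degp size_poly1.
  - by rewrite mulf_neq0 // degpM.
  - by [].
by [].
Qed.

Lemma degp_prod_XsubC (I : finType) (c : I -> K) (e : I -> nat) :
  degp (\prod_i ('X - (c i)%:P) ^+ e i) = (\sum_i e i)%N.
Proof.
rewrite degp_prod => [|i]; last by rewrite expf_neq0 ?polyXsubC_eq0.
by apply: eq_bigr => i _; rewrite degpX degp_XsubC mul1n.
Qed.

End Degree.

Section RadicalInfinity.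
Variables (K : closedFieldType) (F : fieldExtType (ratfun K)).
Variable (Q : place (const_ext F)).
Hypothesis Qx : (Q (evalx F 'X) < 0)%E.

Let X_neq0 : evalx F 'X != 0.
Proof. by rewrite evalx_eq0 polyX_eq0. Qed.

Lemma ordv_X_lt0 : ordv Q (evalx F 'X) < 0.
Proof. by move: Qx; rewrite place_fin // lte_fin. Qed.

(** Over K the polynomial splits, and each factor x - c has the order of x because constants have no
    pole. *)
Lemma ordv_evalx_inf p : p != 0 ->
  ordv Q (evalx F p) = ordv Q (evalx F 'X) * (degp p)%:Z.
Proof.
move=> p0; have [rs def_p] := closed_field_poly_normal p.
have lc : lead_coef p != 0 by rewrite lead_coef_eq0.
have -> : degp p = size rs.
  by rewrite /degp def_p size_scale // size_prod_XsubC.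
have rs0 (s : seq K) : \prod_(z <- s) ('X - z%:P) != 0.
  by rewrite -size_poly_eq0 size_prod_XsubC.
rewrite def_p -mul_polyC rmorphM ordvM ?evalx_eq0 ?polyC_eq0 //.
rewrite evalxC ordvC // add0r.
elim: rs {def_p} => [|c rs IH]; first by rewrite big_nil rmorph1 ordv1 mulr0.
rewrite big_cons rmorphM ordvM ?evalx_eq0 ?polyXsubC_eq0 // IH.
suff -> : ordv Q (evalx F ('X - c%:P)) = ordv Q (evalx F 'X) by rewrite /= intS; ring.
congr fine; rewrite rmorphB; apply: placeD_lt; rewrite placeN.
by rewrite evalxC; apply: lt_le_trans Qx _; exact: placeC_ge0.
Qed.

(* The orders of the nonzero a_j w_j at Q are pairwise distinct, as is seen modulo m
   after raising to the m-th power, so the largest pole survives in the sum. *)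
Lemma radical_sum_inf (m : nat) (w : 'I_m -> F) (g a : 'I_m -> {poly K}) :
  (0 < m)%N ->
  (forall j, w j ^+ m = evalx F (g j)) -> (forall j, g j != 0) ->
  (forall i j, degp (g i) = degp (g j) %[mod m] -> i = j) ->
  (exists j, a j != 0) ->
  let N j := (m * degp (a j) + degp (g j))%N in
  let z := \sum_j evalx F (a j) * w j in
  exists j, [/\ a j != 0, z != 0, ordv Q z *+ m = ordv Q (evalx F 'X) * (N j)%:Z
              & forall i, a i != 0 -> (N i <= N j)%N].
Proof.
move=> m0 wg g0 g_inj [j1 aj1] N z.
have w0 j : w j != 0.
  apply/eqP => wj; have := wg j; rewrite wj expr0n gtn_eqF // => /esym/eqP.
  by rewrite evalx_eq0 (negPf (g0 j)).
pose f j := evalx F (a j) * w j.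
have f0 j : (f j != 0) = (a j != 0).
  by rewrite /f mulf_eq0 (negPf (w0 j)) orbF evalx_eq0.
have ordf j : a j != 0 -> ordv Q (f j) *+ m = ordv Q (evalx F 'X) * (N j)%:Z.
  move=> aj; rewrite -ordvX ?f0 // exprMn wg -rmorphXn -rmorphM.
  have aj_m := expf_neq0 m aj.
  rewrite [LHS]ordv_evalx_inf ?mulf_neq0 // degpM //.
  by rewrite degpX /N mulnC.
have X0 := ordv_X_lt0.
have f_inj i j : f i != 0 -> f j != 0 -> Q (f i) = Q (f j) -> i = j.
  move=> fi fj; rewrite !place_fin // => -[eq_ord].
  rewrite f0 in fi; rewrite f0 in fj.
  have : ordv Q (f i) *+ m = ordv Q (f j) *+ m by rewrite eq_ord.
  rewrite !ordf // => /(mulfI (ltr0_neq0 X0)) [eqN].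
  apply: g_inj; have := congr1 (modn^~ m) eqN.
  by rewrite /N ![(m * _)%N]mulnC !modnMDl.
have [|j [fj Qz j_min]] := place_sum_distinct f_inj; first by exists j1; rewrite f0.
have z0 : z != 0.
  apply/eqP => z0; move: Qz; rewrite -/z z0 place0 => /esym/place_val_eqy/eqP.
  exact/negP.
exists j; rewrite -f0 fj; split=> //.
  by rewrite {1}/ordv Qz ordf // -f0.
move=> i ai; have fi : f i != 0 by rewrite f0.
have := j_min i; rewrite !place_fin // lee_fin.
rewrite -(ler_pMn2r m0) ordf -?f0 // ordf //.
by rewrite ler_nM2l.
Qed.

(** The numbers j deg h, j < m, are distinct modulo m, so the terms of a nonzero combination of the
    w^j cannot cancel at the pole Q of x. *)
Lemma radical_free (m : nat) (w : F) (h : {poly K}) (P : {poly {poly K}}) :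
  (0 < m)%N -> w ^+ m = evalx F h -> h != 0 -> coprime m (degp h) ->
  (size P <= m)%N -> eval2 w P = 0 -> P = 0.
Proof.
move=> m0 wh h0 cop szP; apply: contra_eq => P0.
have -> : eval2 w P = \sum_(j < m) evalx F P`_j * w ^+ j.
  rewrite eval2E (@horner_coef_wide _ m).
    by apply: eq_bigr => i _; rewrite coef_map_id0 ?rmorph0.
  by rewrite size_map_poly_id0 // evalx_eq0 lead_coef_eq0.
have [||||j [_ z0 _ _]//] :=
    @radical_sum_inf m (fun j => w ^+ j) (fun j => h ^+ j) (fun j => P`_j) m0.
- by move=> j; rewrite exprAC wh rmorphXn.
- by move=> j; rewrite expf_neq0.
- move=> i j; rewrite !degpX => /eqP.
  wlog : i j / (i <= j)%N.
    move=> IH e; have [|/ltnW] := leqP i j; move/IH; first exact.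
    by rewrite eq_sym => /(_ e).
  move=> ij; rewrite eq_sym eqn_mod_dvd ?leq_mul2l ?ij ?orbT // -mulnBr.
  rewrite Gauss_dvdr // => /dvdn_leq; rewrite subn_gt0.
  have ltjm := ltn_ord j; move=> dvd_le; apply/val_inj/eqP => /=.
  by rewrite eqn_leq ij leqNgt; apply/negP => /dvd_le; lia.
have sz1 : ((size P).-1 < m)%N by rewrite prednK // size_poly_gt0.
by exists (Ordinal sz1); rewrite /= -lead_coefE lead_coef_eq0.
Qed.

End RadicalInfinity.

(** * Riemann-Roch spaces and the genus *)

Section Dimension.
Variables (K L : fieldType) (iota : {rmorphism K -> L}).

Definition lin_indep n (b : 'I_n -> L) : Prop :=
  forall c : 'I_n -> K, \sum_i iota (c i) * b i = 0 -> forall i, c i = 0.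

(** A bound through independent families, so that enlarged spaces can be bounded without exhibiting
    a basis. *)
Definition dim_le (V : set L) (l : int) : Prop :=
  forall n (b : 'I_n -> L), (forall i, V (b i)) -> lin_indep b -> n%:Z <= l.

Lemma has_dim_le V l : has_dim iota V l -> dim_le V l%:Z.
Proof.
move=> [e [_ e_basis]] n b bV b_indep.
have /choice[c def_c] : forall i, exists c : {ffun 'I_l -> K},
    b i = \sum_k iota (c k) * e k.
  by move=> i; have [c [-> _]] := e_basis _ (bV i); exists c.
pose M := \matrix_(i < n, k < l) c i k.
suff /eqP <- : row_free M by rewrite lez_nat rank_leq_col.
apply: inj_row_free => v vM.
apply/rowP => i; rewrite mxE; apply: (b_indep (fun i => v 0 i)) => {i}.
transitivity (\sum_k iota ((v *m M) 0 k) * e k); last first.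
  by rewrite vM; apply: big1 => k _; rewrite mxE rmorph0 mul0r.
under [RHS]eq_bigr do rewrite mxE rmorph_sum mulr_suml.
rewrite exchange_big; apply: eq_bigr => i _ /=.
rewrite def_c mulr_sumr; apply: eq_bigr => k _.
by rewrite mxE rmorphM mulrA.
Qed.

(** A member b_i0 outside L(D) has order exactly -(coeff P D) - 1 at P. As residues lie in K,
    subtracting constant multiples of b_i0 moves all other members into L(D). *)
Lemma RR_spaceD1 (D : divisor iota) (P : place iota) l :
  (forall z, (0 <= P z)%E -> exists k, has_residue P z k) ->
  dim_le (RR_space D) l -> dim_le (RR_space (D + << P >>)) (l + 1).
Proof.
move=> P_res D_le n b bD b_indep.
have l0 : 0 <= l by apply: (D_le 0%N (fun=> 0)) => [[]|c _ []].
have [all_D|] := pselect (forall i, RR_space D (b i)).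
  by apply: le_trans (D_le n b all_D b_indep) _; rewrite lerDl.
case: n b bD b_indep => [|n] b bD b_indep; first by move=> _; rewrite addr_ge0.
move=> /existsNP[i0 bi0D].
pose k := coeff P D.
have coeffDP Q : coeff Q (D + << P >>) = coeff Q D + (P == Q)%:R.
  by rewrite coeffD coeffU mul1r.
have bQ i Q : Q != P -> ((- coeff Q D)%:E <= Q (b i))%E.
  by move=> QP; have := bD i Q; rewrite coeffDP eq_sym (negPf QP) addr0.
have bP i : ((- k - 1)%:E <= P (b i))%E.
  by have := bD i P; rewrite coeffDP eqxx opprD.
have bi0 : b i0 != 0.
  by apply: contra_notN bi0D => /eqP -> Q; rewrite place0 leey.
have ord_i0 : ordv P (b i0) = - k - 1.
  have := bP i0; rewrite place_fin // lee_fin => ge_k.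
  apply/eqP; rewrite eq_le ge_k andbT leNgt; apply/negP => gt_k.
  apply: bi0D => Q; have [->|/bQ //] := eqVneq Q P.
  by rewrite place_fin // lee_fin -/k; lia.
have /choice[c c_res] : forall i, exists c, has_residue P (b i / b i0) c.
  move=> i; apply: P_res; rewrite place_valM.
  rewrite (place_fin P (invr_neq0 bi0)) ordvV // ord_i0.
  have [->|bi] := eqVneq (b i) 0; first by rewrite place0.
  by have := bP i; rewrite !place_fin // -EFinD !lee_fin; lia.
pose b' (i : 'I_n) := b (fintype.lift i0 i) - iota (c (fintype.lift i0 i)) * b i0.
have n_le : n%:Z <= l.
  apply: (D_le n b').
    move=> i Q; have [->|QP] := eqVneq Q P; last first.
      apply: placeD_ge; first exact: bQ.
      rewrite placeN place_valM -[X in (X <= _)%E]add0e.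
      by apply: leeD; [exact: placeC_ge0|exact: bQ].
    have -> : b' i = (b (fintype.lift i0 i) / b i0 - iota (c (fintype.lift i0 i))) * b i0.
      by rewrite /b'; field.
    rewrite place_valM (place_fin P bi0) ord_i0 -/k.
    have := c_res (fintype.lift i0 i); rewrite /has_residue.
    set u := _ - _; have [->|u0] := eqVneq u 0.
      by rewrite place0 addye // leey.
    by rewrite place_fin // lte_fin -EFinD lee_fin; lia.
  move=> a sum0 i.
  (* A relation among the b' becomes one among the b; the coefficient of b_i0 collects the
     subtracted multiples. *)
  pose a' (j : 'I_n.+1) := if unlift i0 j is Some i then a i
                           else - \sum_i a i * c (fintype.lift i0 i).
  have := b_indep a' _ (fintype.lift i0 i); rewrite /a' liftK; apply.
  rewrite -[RHS]sum0 (bigD1 i0) //= unlift_none.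
  rewrite (reindex_omap (fintype.lift i0) (unlift i0)) /=; last first.
    by move=> j ji0; case: unliftP ji0 => [i' -> //|->]; rewrite eqxx.
  have lift_cond (j : 'I_n) :
      (fintype.lift i0 j != i0) && (unlift i0 (fintype.lift i0 j) == Some j).
    by rewrite eq_sym neq_lift liftK eqxx.
  rewrite [X in _ + X](eq_bigl predT) => [|j]; last exact: lift_cond.
  rewrite rmorphN rmorph_sum mulNr mulr_suml -sumrN -big_split.
  by apply: eq_bigr => j _ /=; rewrite liftK rmorphM /b'; ring.
by rewrite -addn1 PoszD lerD2r.
Qed.

Lemma RR_space_effective (D : divisor iota) (s : seq (place iota)) l :
  (forall P, P \in s -> forall z, (0 <= P z)%E -> exists k, has_residue P z k) ->
  dim_le (RR_space D) l ->
  dim_le (RR_space (D + \sum_(P <- s) << P >>)) (l + (size s)%:Z).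
Proof.
elim: s => [|P s IH] s_res D_le; first by rewrite big_nil !addr0.
rewrite big_cons addrCA addrC [size (P :: s)]/= -[(size s).+1]addn1 PoszD addrA.
apply: RR_spaceD1; first by apply: s_res; rewrite mem_head.
by apply: IH => // Q Qs; apply: s_res; rewrite inE Qs orbT.
Qed.

Lemma effective_seq (G : divisor iota) : (forall P, 0 <= coeff P G) ->
  exists s : seq (place iota),
    [/\ G = \sum_(P <- s) << P >>, deg G = (size s)%:Z
      & forall P, P \in s -> coeff P G != 0].
Proof.
move=> G0; pose s := flatten [seq nseq `|coeff P G|%N P | P <- dom G].
have G_s : G = \sum_(P <- s) << P >>.
  rewrite /s big_flatten big_map -[LHS]freeg_sumE; apply: eq_bigr => P _.
  rewrite big_nseq -Monoid.iteropE /=.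
  have -> : iterop `|coeff P G| +%R << P >> 0 = << P >> *+ `|coeff P G| by [].
  by rewrite freegU_muln natz gez0_abs.
exists s; split=> //.
  rewrite {1}G_s raddf_sum /=; elim: (s) => [|P t IH]; first by rewrite big_nil.
  by rewrite big_cons IH degU [size (P :: t)]/= -[(size t).+1]add1n PoszD.
move=> P /flattenP[t /mapP[Q Qdom ->]] /nseqP[-> _].
by rewrite -mem_dom.
Qed.

Lemma distinct_ordv_indep (P : place iota) n (b : 'I_n -> L) :
  (forall i, b i != 0) -> (forall i j, ordv P (b i) = ordv P (b j) -> i = j) ->
  lin_indep b.
Proof.
move=> b0 b_inj c sum0 i; apply/eqP/negPn/negP => ci.
pose f i := iota (c i) * b i.
have f0 j : (f j != 0) = (c j != 0).
  by rewrite /f mulf_eq0 (negPf (b0 _)) orbF fmorph_eq0.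
have [||j [fj Pj _]] := @place_sum_distinct _ _ _ P _ f.
- move=> j k; rewrite !f0 => cj ck; rewrite !place_fin ?f0 // => -[].
  by rewrite !ordvM ?fmorph_eq0 // !ordvC // !add0r => /b_inj.
- by exists i; rewrite f0.
move: Pj; rewrite sum0 place0 => /esym/place_val_eqy/eqP.
exact/negP.
Qed.

Lemma lin_indepM n (b : 'I_n -> L) z :
  z != 0 -> lin_indep b -> lin_indep (fun i => b i * z).
Proof.
move=> z0 b_indep c sum0; apply: b_indep; apply: (mulIf z0).
by rewrite mul0r -[RHS]sum0 mulr_suml; apply: eq_bigr => i _; rewrite mulrA.
Qed.

End Dimension.

(** * Residue classes, Apery sets and the number of gaps *)

Lemma mulm_inj (m a : nat) (i j : 'I_m) :
  coprime m a -> i * a = j * a %[mod m] -> i = j.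
Proof.
move=> cop; wlog le_ij : i j / (i <= j)%N.
  move=> IH e; have [|/ltnW] := leqP i j; move/IH; first exact.
  by move=> /(_ (esym e)).
move=> /esym/eqP; rewrite eqn_mod_dvd ?leq_mul2r ?le_ij ?orbT // -mulnBl.
rewrite Gauss_dvdl // -eqn_mod_dvd // !modn_small // => /eqP ji.
exact/esym/val_inj.
Qed.

(** A form of Hermite's identity: from N to N + 1 the term floor(N / m) leaves the sum and floor((N
    + m) / m), larger by one, enters. *)
Lemma sum_divn_shift m N : (0 < m)%N -> (\sum_(k < m) (N + k) %/ m = N)%N.
Proof.
case: m => // m _; elim: N => [|N IH].
  by apply: big1 => k _; rewrite add0n divn_small.
move: IH; rewrite big_ord_recl big_ord_recr /= addn0 => IH.
have -> : (N.+1 + m = 1 * m.+1 + N)%N by lia.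
rewrite divnMDl // -[in RHS]IH add1n addnS addnC; congr (_ + _).+1.
by apply: eq_bigr => k _; rewrite addSnnS.
Qed.

Section Apery.
Variables (m : nat) (d : nat -> nat).
Hypotheses (m_gt0 : (0 < m)%N)
  (d_inj : forall i j : 'I_m, d i = d j %[mod m] -> i = j).

Lemma residue_surj s : exists j : 'I_m, d j = s %[mod m].
Proof.
pose f (j : 'I_m) : 'I_m := Ordinal (ltn_pmod (d j) m_gt0).
have f_inj : injective f by move=> i j [] /d_inj.
have [g _ fK] := injF_bij f_inj.
exists (g (Ordinal (ltn_pmod s m_gt0))).
by have := congr1 val (fK (Ordinal (ltn_pmod s m_gt0))).
Qed.

(** The number of gaps of the set of all d j + m t: in the class of d j, exactly floor(d j / m)
    natural numbers are missing. *)
Definition gap_count : nat := (\sum_(j < m) d j %/ m)%N.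

Lemma sum_residues (h : nat -> nat) :
  (\sum_(j < m) h (d j %% m) = \sum_(j < m) h j)%N.
Proof.
pose f (j : 'I_m) : 'I_m := Ordinal (ltn_pmod (d j) m_gt0).
have f_inj : injective f by move=> i j [] /d_inj.
by rewrite [RHS](reindex_inj f_inj).
Qed.

Lemma gap_countE : (m * gap_count + \sum_(j < m) j = \sum_(j < m) d j)%N.
Proof.
rewrite -(sum_residues id) big_distrr -big_split; apply: eq_bigr => j _ /=.
by rewrite mulnC -divn_eq.
Qed.

(** A pair (j, t) stands for the function x^t e_j, of pole order m t + d j; the range t <= n loses
    nothing as m > 0. *)
Definition below (n : nat) : {set 'I_m * 'I_n.+1} :=
  [set u : 'I_m * 'I_n.+1 | (m * u.2 + d u.1 <= n)%N].

(** The column of j has floor((n - d j) / m) + 1 entries. Replacing d j by its residue adds floor(d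
    j / m), in total [gap_count], after which the residues run over 0, ..., m - 1. *)
Lemma card_below n : (m <= n)%N -> (forall j : 'I_m, (d j <= n)%N) ->
  (#|below n| + gap_count = n.+1)%N.
Proof.
move=> m_n d_n; rewrite -sum1_card.
rewrite (eq_bigl (fun u : 'I_m * 'I_n.+1 => xpredT u.1 && (m * u.2 + d u.1 <= n)%N));
  last by move=> u; rewrite inE.
rewrite -(pair_big_dep xpredT (fun (j : 'I_m) (t : 'I_n.+1) => (m * t + d j <= n)%N)
           (fun _ _ => 1%N)) /=.
have col_card (j : 'I_m) :
    (\sum_(t < n.+1 | m * t + d j <= n) 1 = ((n - d j) %/ m).+1)%N.
  have q_n : ((n - d j) %/ m < n.+1)%N.
    by rewrite ltnS (leq_trans (leq_div _ _)) ?leq_subr.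
  rewrite (eq_bigl (fun t : 'I_n.+1 => (t < ((n - d j) %/ m).+1)%N)); last first.
    by move=> t; rewrite ltnS leq_divRL // mulnC leq_subRL // addnC.
  by rewrite -(big_ord_widen _ (fun=> 1%N) q_n) sum_nat_const card_ord muln1.
rewrite (eq_bigr (fun j : 'I_m => ((n - d j) %/ m).+1)) => [|j _]; last exact: col_card.
rewrite -big_split /=.
rewrite (eq_bigr (fun j : 'I_m => ((n - d j %% m) %/ m).+1)) => [|j _]; last first.
  have -> : (n - d j = n - d j %% m - d j %/ m * m)%N.
    by rewrite [in LHS](divn_eq (d j) m) addnC subnDA.
  rewrite divnBMl.
  rewrite addSn subnK // leq_divRL // -(leq_add2r (d j %% m)) -divn_eq subnK //.
  exact: leq_trans (leq_mod _ _) (d_n j).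
rewrite (sum_residues (fun k => ((n - k) %/ m).+1)).
(* For k = m - 1 - j the term floor((n - k) / m) + 1 is floor((n + 1 + j) / m); m <= n prevents
   truncation of n - k. *)
rewrite (reindex_inj rev_ord_inj) -[RHS](sum_divn_shift n.+1 m_gt0) /=.
apply: eq_bigr => j _; have jm := ltn_ord j.
have -> : (n.+1 + j = 1 * m + (n - (m - j.+1)))%N by lia.
by rewrite divnMDl.
Qed.

End Apery.

(** * The genus from a basis with pole orders distinct modulo m *)

Lemma evalx_coef (K : fieldType) (F : fieldExtType (ratfun K)) n (p : {poly K}) :
  (size p <= n)%N ->
  evalx F p = \sum_(t < n) const_ext F p`_t * evalx F 'X ^+ t.
Proof.
move=> szp; have -> : p = \poly_(t < n) p`_t.
  apply/polyP => t; rewrite coef_poly; case: ltnP => // le_nt.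
  by rewrite nth_default // (leq_trans szp).
rewrite poly_def rmorph_sum; apply: eq_bigr => t _.
by rewrite -poly_def coef_poly ltn_ord -mul_polyC rmorphM rmorphXn.
Qed.

Section Genus.
Variables (K : closedFieldType) (F : fieldExtType (ratfun K)).
Variables (Qinf : place (const_ext F)) (m : nat) (E : nat -> F) (d : nat -> nat).
(** [ordv_sum] says that the largest pole at Qinf never cancels. In [places_over], the list s
    counted with multiplicity is a divisor of degree m dominating the zeros of x - c. *)
Hypotheses (m_gt0 : (0 < m)%N)
  (d_inj : forall i j : 'I_m, d i = d j %[mod m] -> i = j)
  (X_regular : forall P : place (const_ext F), P != Qinf -> (0 <= P (evalx F 'X))%E)
  (E_regular : forall (P : place (const_ext F)) j, P != Qinf -> (0 <= P (E j))%E)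
  (ordv_X : ordv Qinf (evalx F 'X) = - m%:Z)
  (ordv_E : forall j, ordv Qinf (E j) = - (d j)%:Z) (E_neq0 : forall j, E j != 0)
  (E_basis : forall z, (forall P : place (const_ext F), P != Qinf -> (0 <= P z)%E) ->
     exists a : 'I_m -> {poly K}, z = \sum_j evalx F (a j) * E j)
  (ordv_sum : forall a : 'I_m -> {poly K}, \sum_j evalx F (a j) * E j != 0 ->
     exists j, [/\ a j != 0,
       ordv Qinf (\sum_j evalx F (a j) * E j) = - (m * degp (a j) + d j)%N%:Z
     & forall i, a i != 0 -> (m * degp (a i) + d i <= m * degp (a j) + d j)%N])
  (finite_center : forall P : place (const_ext F), P != Qinf ->
     exists c, (0 < P (evalx F ('X - c%:P))%R)%E)
  (places_over : forall c, exists s : seq (place (const_ext F)),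
     [/\ size s = m,
      forall P, P \in s -> (0 < P (evalx F ('X - c%:P))%R)%E /\
        forall z, (0 <= P z)%E -> exists k, has_residue P z k
    & forall P : place (const_ext F), (0 < P (evalx F ('X - c%:P))%R)%E ->
        (P (evalx F ('X - c%:P))%R <= (count_mem P s)%:Z%:E)%E]).

Let X_neq0 : evalx F 'X != 0.
Proof. by rewrite evalx_eq0 polyX_eq0. Qed.

Definition monomial n (i : 'I_#|below m d n|) : F :=
  evalx F 'X ^+ (enum_val i).2 * E (enum_val i).1.

Lemma monomial_neq0 n (i : 'I_#|below m d n|) : monomial i != 0.
Proof. by rewrite mulf_neq0 ?expf_neq0 ?E_neq0. Qed.

Lemma ordv_monomial n (i : 'I_#|below m d n|) :
  ordv Qinf (monomial i) = - (m * (enum_val i).2 + d (enum_val i).1)%N%:Z.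
Proof.
rewrite /monomial ordvM ?expf_neq0 ?E_neq0 // ordvX // ordv_X ordv_E.
by rewrite -mulr_natr natz PoszD PoszM; ring.
Qed.

Lemma monomial_indep n : lin_indep (const_ext F) (@monomial n).
Proof.
apply: (distinct_ordv_indep (P := Qinf)); first exact: monomial_neq0.
move=> i i'; rewrite !ordv_monomial => /oppr_inj[] eq_N; apply: enum_val_inj.
move: eq_N; case: (enum_val i) (enum_val i') => j t [j' t'] /= eq_N.
have jj' : j = j'.
  apply: d_inj; have := congr1 (modn^~ m) eq_N.
  by rewrite ![(m * _)%N]mulnC !modnMDl.
move: eq_N; rewrite jj' => /addIn/eqP; rewrite eqn_pmul2l // => /eqP tt'.
by congr pair; apply: val_inj.
Qed.

Lemma monomial_regular n (i : 'I_#|below m d n|) (P : place (const_ext F)) :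
  P != Qinf -> (0 <= P (monomial i))%E.
Proof.
move=> PQ; apply: placeM_ge0; last exact: E_regular.
by apply: placeX_ge0; exact: X_regular.
Qed.

Lemma monomial_pole n (i : 'I_#|below m d n|) : - n%:Z <= ordv Qinf (monomial i).
Proof.
rewrite ordv_monomial lerN2 lez_nat.
by have := enum_valP i; rewrite inE.
Qed.

Lemma RR_space_Qinf n z :
  RR_space << n%:Z *g Qinf >> z <->
  ((- n%:Z)%:E <= Qinf z)%E /\ forall P : place (const_ext F), P != Qinf -> (0 <= P z)%E.
Proof.
split=> [zD|[zQ zP] P].
  split=> [|P PQ]; first by have := zD Qinf; rewrite coeffU eqxx mulr1.
  by have := zD P; rewrite coeffU eq_sym (negPf PQ) mulr0 oppr0.
rewrite coeffU; have [<-|QP] := eqVneq Qinf P; first by rewrite mulr1.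
by rewrite mulr0 oppr0; apply: zP; rewrite eq_sym.
Qed.

(** By [ordv_sum] each term of z = sum_j a_j e_j has pole order at most n, hence expands into the
    listed monomials. *)
Lemma monomial_basis n :
  is_basis_family (const_ext F) (RR_space << n%:Z *g Qinf >>) (@monomial n).
Proof.
split=> [i|z /RR_space_Qinf[zQ zP]].
  apply/RR_space_Qinf; split; last by move=> P; exact: monomial_regular.
  by rewrite place_fin ?monomial_neq0 // lee_fin monomial_pole.
suff [c def_z] : exists c : {ffun 'I_#|below m d n| -> K},
    z = \sum_i const_ext F (c i) * monomial i.
  exists c; split=> // c' def_z'; apply/ffunP => i; apply/eqP.
  rewrite -subr_eq0; apply/eqP; apply: (@monomial_indep n (fun i => c i - c' i)).
  under eq_bigr do rewrite rmorphB mulrBl.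
  by rewrite sumrB -def_z -def_z' subrr.
have [->|z0] := eqVneq z 0.
  by exists 0; rewrite big1 // => i _; rewrite ffunE rmorph0 mul0r.
have [a def_z] := E_basis zP.
have a_deg i : a i != 0 -> (m * degp (a i) + d i <= n)%N.
  move=> ai; have z0' := z0; rewrite def_z in z0'.
  have [j [_ ord_z /(_ i ai) le_ij]] := ordv_sum z0'.
  apply: (leq_trans le_ij); rewrite -lez_nat -lerN2 -ord_z -def_z.
  by move: zQ; rewrite place_fin // lee_fin.
exists [ffun i : 'I_#|below m d n| => (a (enum_val i).1)`_(enum_val i).2].
pose G (u : 'I_m * 'I_n.+1) := const_ext F (a u.1)`_u.2 * (evalx F 'X ^+ u.2 * E u.1).
rewrite [RHS](eq_bigr (fun i => G (enum_val i))) => [|i _]; last by rewrite ffunE.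
rewrite -(big_enum_val G) def_z.
rewrite [RHS]big_mkcond.
transitivity (\sum_j \sum_t if (j, t) \in below m d n then G (j, t) else 0);
  last by rewrite pair_bigA; apply: eq_bigr => -[].
apply: eq_bigr => j _.
have sz_a : (size (a j) <= n.+1)%N.
  have [->|aj] := eqVneq (a j) 0; first by rewrite size_poly0.
  rewrite (polySpred aj) ltnS; apply: leq_trans (a_deg j aj).
  by apply: leq_trans (leq_addr _ _); rewrite leq_pmull.
rewrite (evalx_coef F sz_a) mulr_suml; apply: eq_bigr => t _.
rewrite inE /G -mulrA; case: leqP => // lt_n.
have [->|at0] := eqVneq (a j)`_t 0; first by rewrite rmorph0 mul0r.
have aj : a j != 0 by apply: contraNneq at0 => ->; rewrite coef0.
have lt_t : (t < size (a j))%N.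
  by rewrite ltnNge; apply: contra at0 => le_t; rewrite nth_default.
suff : (m * t + d j <= n)%N by rewrite leqNgt lt_n.
apply: leq_trans (a_deg j aj).
by rewrite leq_add2r leq_pmul2l // -ltnS -polySpred.
Qed.

Lemma coeff_sum_seq (s : seq (place (const_ext F))) (P : place (const_ext F)) :
  coeff P (\sum_(Q <- s) << Q >>) = (count_mem P s)%:Z :> int.
Proof.
elim: s => [|Q s IH]; first by rewrite big_nil coeff0.
by rewrite big_cons coeffD coeffU IH mul1r PoszD natz.
Qed.

Lemma finite_place_mem (P : place (const_ext F)) c s :
  (0 < P (evalx F ('X - c%:P))%R)%E ->
  (P (evalx F ('X - c%:P))%R <= (count_mem P s)%:Z%:E)%E -> P \in s.
Proof.
move=> /lt_le_trans lt /lt.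
by rewrite lte_fin ltz_nat -has_count has_pred1.
Qed.

Lemma finite_place_residue (P : place (const_ext F)) : P != Qinf ->
  forall z, (0 <= P z)%E -> exists k, has_residue P z k.
Proof.
move=> /finite_center[c xc]; have [s [_ s_res s_count]] := places_over c.
by have [] := s_res P (finite_place_mem xc (s_count P xc)).
Qed.

Lemma Qinf_X_lt0 : (Qinf (evalx F 'X) < 0)%E.
Proof. by rewrite place_fin // ordv_X lte_fin oppr_lt0 ltz_nat. Qed.

Lemma over_finite (P : place (const_ext F)) c :
  (0 < P (evalx F ('X - c%:P))%R)%E -> P != Qinf.
Proof.
apply: contraTneq => ->; rewrite place_fin ?evalx_eq0 ?polyXsubC_eq0 //.
rewrite (ordv_evalx_inf Qinf_X_lt0) ?polyXsubC_eq0 // degp_XsubC mulr1 ordv_X.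
by rewrite lte_fin -leNgt oppr_le0.
Qed.

(* The divisor D is dominated by D' = n_0 Qinf + N sum_c (zeros of x - c), and
   multiplication by prod_c (x - c)^N identifies the space of D' with that of n Qinf. *)
Lemma genus_ge (D : divisor (const_ext F)) (l : nat) :
  has_dim (const_ext F) (RR_space D) l ->
  deg D - l%:Z + 1 <= (gap_count m d)%:Z.
Proof.
move=> /has_dim_le D_le; have /choice[pl plP] := places_over.
have /choice[ctr ctrP] : forall P, exists c,
    P != Qinf -> (0 < P (evalx F ('X - c%:P))%R)%E.
  move=> P; have [->|/finite_center[c xc]] := eqVneq P Qinf; first by exists 0.
  by exists c.
have [cs size_cs cs_ctr] : exists2 cs : seq K, (0 < size cs)%N
    & forall P, P \in dom D -> ctr P \in cs.
  (* The extra 0 keeps the list nonempty when D has empty support, which gives N <= N m |cs|. *)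
  by exists (0 :: map ctr (dom D)) => // P PD; rewrite inE map_f ?orbT.
pose n0 := coeff Qinf D.
(* The summands make D' dominate D, keep n nonnegative, and bring n into the range of
   [card_below]. *)
pose N := (\sum_(P <- dom D) `|coeff P D| + `|n0| + m + \sum_(j < m) d j)%N.
pose G : divisor (const_ext F) := (\sum_(c <- cs) \sum_(P <- pl c) << P >>) *+ N.
have coeffG P : coeff P G = (N * \sum_(c <- cs) count_mem P (pl c))%N%:Z.
  rewrite coeffMn raddf_sum /= PoszM -[N%:Z]natz mulr_natl; congr (_ *+ _).
  elim: (cs) => [|c t IH]; first by rewrite !big_nil.
  by rewrite !big_cons IH PoszD -coeff_sum_seq.
have degG : deg G = (N * (m * size cs))%N%:Z.
  rewrite degMn raddf_sum /= PoszM -[N%:Z]natz mulr_natl; congr (_ *+ _).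
  elim: (cs) => [|c t IH]; first by rewrite big_nil muln0.
  rewrite big_cons IH [size (c :: t)]/= mulnS PoszD; congr (_ + _).
  have [<- _ _] := plP c; elim: (pl c) => [|P u IHu]; first by rewrite big_nil deg0.
  by rewrite big_cons degD degU IHu [size (P :: u)]/= -add1n PoszD.
pose p : {poly K} := (\prod_(c <- cs) ('X - c%:P)) ^+ N.
have prod0 (t : seq K) : \prod_(c <- t) ('X - c%:P) != 0.
  by rewrite -size_poly_eq0 size_prod_XsubC.
have p0 : p != 0 by rewrite expf_neq0.
have ep0 : evalx F p != 0 by rewrite evalx_eq0.
have ord_inf_p : ordv Qinf (evalx F p) = - (N * (m * size cs))%N%:Z.
  rewrite (ordv_evalx_inf Qinf_X_lt0) // ordv_X degpX /degp size_prod_XsubC.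
  by rewrite mulNr -PoszM mulnA mulnC.
have ord_p P : P != Qinf -> ordv P (evalx F p) <= coeff P G.
  move=> PQ; rewrite coeffG rmorphXn ordvX ?evalx_eq0 // PoszM -[N%:Z]natz mulr_natl.
  rewrite lerMn2r; apply/orP; right; elim: (cs) => [|c t IH].
    by rewrite !big_nil rmorph1 ordv1.
  rewrite !big_cons rmorphM ordvM ?evalx_eq0 ?polyXsubC_eq0 // PoszD.
  apply: lerD IH; have [_ _ /(_ P)] := plP c.
  rewrite place_fin ?evalx_eq0 ?polyXsubC_eq0 // lte_fin lee_fin.
  by case: ltP => [_ /(_ isT)//|le0 _]; exact: le_trans le0 _.
pose n := `|(n0 + (N * (m * size cs))%N%:Z)%R|%N.
have N_le : (N <= N * (m * size cs))%N by rewrite leq_pmulr // muln_gt0 m_gt0.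
have def_n : n%:Z = n0 + (N * (m * size cs))%N%:Z.
  rewrite /n gez0_abs //; move: N_le; rewrite {1}/N; lia.
have n_ge : (m + \sum_(j < m) d j <= n)%N.
  rewrite -lez_nat def_n; move: N_le; rewrite {1}/N; lia.
pose D' := << n0 *g Qinf >> + G.
have pl_Qinf c : count_mem Qinf (pl c) = 0%N.
  apply/eqP; rewrite eqn0Ngt -has_count has_pred1; apply/negP => Qpl.
  have [_ /(_ _ Qpl)[/over_finite]] := plP c.
  by rewrite eqxx.
have D'_Qinf : coeff Qinf D' = n0.
  by rewrite coeffD coeffU eqxx mulr1 coeffG big1 ?muln0 ?addr0.
have D'_fin P : P != Qinf -> coeff P D' = coeff P G.
  by move=> PQ; rewrite coeffD coeffU eq_sym (negPf PQ) mulr0 add0r.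
have D'D_ge0 P : 0 <= coeff P (D' - D).
  rewrite coeffB; have [->|PQ] := eqVneq P Qinf; first by rewrite D'_Qinf subrr.
  rewrite D'_fin // subr_ge0; have [PD|/coeff_outdom -> ] := boolP (P \in dom D).
    apply: le_trans (ler_norm _) _; rewrite coeffG -abszE lez_nat.
    apply: (@leq_trans N).
      by rewrite /N (big_rem P) //=; lia.
    rewrite leq_pmulr // (big_rem (ctr P)) ?cs_ctr //=.
    rewrite addn_gt0 -has_count has_pred1.
    have [_ _ /(_ P (ctrP P PQ)) P_pl] := plP (ctr P).
    by rewrite (finite_place_mem (ctrP P PQ) P_pl).
  by rewrite coeffG.
(* D' and D agree at Qinf, so only finite places, with residue field K, are added to D. *)
have [s [def_s deg_s s_supp]] := effective_seq D'D_ge0.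
have s_res P : P \in s -> forall z, (0 <= P z)%E -> exists k, has_residue P z k.
  move=> /s_supp PD'D; apply: finite_place_residue.
  by apply: contraNneq PD'D => ->; rewrite coeffB D'_Qinf subrr.
have := RR_space_effective s_res D_le; rewrite -def_s -deg_s addrC subrK => D'_le.
have inE_fam (i : 'I_#|below m d n|) : RR_space D' (monomial i / evalx F p).
  have mon0 := monomial_neq0 i; have ep0' := invr_neq0 ep0.
  move=> P; rewrite (place_fin P (mulf_neq0 mon0 ep0')).
  rewrite (ordvM P mon0 ep0') (ordvV P ep0) lee_fin.
  have [->|PQ] := eqVneq P Qinf.
    by rewrite D'_Qinf ord_inf_p; have := monomial_pole i; rewrite def_n; lia.
  have := monomial_regular i PQ; rewrite place_fin ?monomial_neq0 // lee_fin.
  by rewrite D'_fin //; have := ord_p P PQ; lia.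
(* The family has n + 1 - [gap_count] members and deg D' = n, whence n + 1 - [gap_count] <= l + n -
   deg D. *)
have := D'_le _ _ inE_fam (lin_indepM (invr_neq0 ep0) (@monomial_indep n)).
have degD' : deg D' = n%:Z by rewrite degD degU degG def_n.
have := @card_below m d m_gt0 d_inj n; rewrite degB degD'.
have d_n (j : 'I_m) : (d j <= n)%N.
  by move: n_ge; rewrite (bigD1 j) //=; lia.
move=> /(_ _ d_n) card_n; have {card_n} := card_n _; lia.
Qed.

Lemma genus_gap_count : is_genus (const_ext F) (gap_count m d).
Proof.
split; last exact: genus_ge.
pose n := (m + \sum_(j < m) d j)%N.
exists << n%:Z *g Qinf >>, #|below m d n|; split.
  by exists (@monomial n); exact: monomial_basis.
rewrite degU.
have := @card_below m d m_gt0 d_inj n (leq_addr _ _).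
have d_n (j : 'I_m) : (d j <= n)%N by rewrite /n (bigD1 j) //=; lia.
by move=> /(_ d_n); lia.
Qed.

End Genus.

(** * The curve y^m = f(x) *)

Section Curve.
Variables (K : closedFieldType) (m r : nat).
Hypotheses (m_gt1 : (1 < m)%N) (mK : m%:R != 0 :> K).
Variables (alpha : 'I_r -> K) (lambda : 'I_r -> nat).
Hypotheses (alpha_inj : injective alpha) (lambda_gt0 : forall i, (0 < lambda i)%N)
  (lambda_lt : forall i, (lambda i < m)%N) (r_gt0 : (0 < r)%N)
  (cop0 : coprime m (\sum_i lambda i)%N) (cop : forall i, coprime m (lambda i)).
Variables (F : fieldExtType (ratfun K)) (y : F).
Hypothesis hF : curve_function_field m alpha lambda y.
Variable Qinf : place (const_ext F).
Hypothesis Qinf_x : (Qinf (evalx F 'X) < 0)%E.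

Local Notation evalx := (evalx F).

Let m_gt0 : (0 < m)%N. Proof. exact: ltnW. Qed.

Definition curve_poly : {poly K} := \prod_i ('X - (alpha i)%:P) ^+ lambda i.

Lemma curve_eq : y ^+ m = evalx curve_poly.
Proof. by case: hF. Qed.

Lemma XsubC_prod_neq0 (e : 'I_r -> nat) :
  \prod_i ('X - (alpha i)%:P) ^+ e i != 0 :> {poly K}.
Proof. by apply/prodf_neq0 => i _; rewrite expf_neq0 ?polyXsubC_eq0. Qed.

Lemma y_neq0 : y != 0.
Proof.
apply/eqP => y0; have := curve_eq; rewrite y0 expr0n gtn_eqF // => /esym/eqP.
by rewrite evalx_eq0 (negPf (XsubC_prod_neq0 _)).
Qed.

Definition cleared (w z : F) : Prop :=
  exists q P, q != 0 /\ evalx q * z = eval2 w P.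

Lemma clearedD w z1 z2 : cleared w z1 -> cleared w z2 -> cleared w (z1 + z2).
Proof.
move=> [q1 [P1 [q10 e1]]] [q2 [P2 [q20 e2]]].
exists (q1 * q2), (q2%:P * P1 + q1%:P * P2).
rewrite mulf_neq0 // rmorphD !rmorphM !eval2C -e1 -e2; split=> //; ring.
Qed.

Lemma clearedM w z1 z2 : cleared w z1 -> cleared w z2 -> cleared w (z1 * z2).
Proof.
move=> [q1 [P1 [q10 e1]]] [q2 [P2 [q20 e2]]].
exists (q1 * q2), (P1 * P2).
rewrite mulf_neq0 // !rmorphM -e1 -e2; split=> //; ring.
Qed.

Lemma cleared_gen w : cleared w y -> forall z, cleared w z.
Proof.
move=> wy z; case: hF => full _.
have cl1 (u : ratfun K) : cleared w u%:A.
  have [n [d [d0 e]]] := fraction_clear_denom u.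
  exists d, n%:P; split=> //; rewrite eval2C.
  by have := congr1 (in_alg F) e; rewrite rmorphM.
have /Fadjoin_polyP[p /polyOverP p1 ->] : z \in <<1; y>>%VS by rewrite full memvf.
rewrite horner_coef; elim/big_ind: _ => [|z1 z2|i _].
- by rewrite -(scale0r 1).
- exact: clearedD.
apply: clearedM; first by have /vlineP[u ->] := p1 i.
elim: (nat_of_ord i) => [|k IH]; first by rewrite expr0 -(scale1r 1).
by rewrite exprS; exact: clearedM.
Qed.

Lemma cleared_y z : cleared y z.
Proof.
apply: cleared_gen; exists 1, 'X.
by rewrite oner_neq0 rmorph1 mul1r eval2X.
Qed.

(** This amounts to irreducibility of W^m - f over K(x), obtained from gcd(m, lambda_0) = 1 through
    pole orders at Qinf. *)
Lemma y_free (P : {poly {poly K}}) : (size P <= m)%N -> eval2 y P = 0 -> P = 0.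
Proof.
apply: (radical_free Qinf_x m_gt0 curve_eq) => //; first exact: XsubC_prod_neq0.
by rewrite degp_prod_XsubC.
Qed.

Lemma curve_unramified_place c b : curve_poly.[c] = b ^+ m -> b != 0 ->
  exists P : place (const_ext F),
  [/\ P (evalx ('X - c%:P)) = 1%:E, has_residue P y b,
      forall z, (0 <= P z)%E -> exists k, has_residue P z k
    & forall Q : place (const_ext F),
        (0 < Q (evalx ('X - c%:P))%R)%E -> has_residue Q y b -> Q = P].
Proof.
move=> fc b0; have := @radical_unramified_point _ _ _ _ _ m_gt0 curve_eq y_free.
by apply=> //; exact: cleared_y.
Qed.

(* With u lambda_i = 1 + k m, the function w = y^u / (x - alpha_i)^k satisfies
   w^m = (x - alpha_i) o^u where o(alpha_i) <> 0, and the plane curve described by x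
   and w is nonsingular at (alpha_i, 0). *)
Lemma curve_branch_place i :
  exists P : place (const_ext F),
  [/\ P (evalx ('X - (alpha i)%:P)) = (m%:Z)%:E,
      forall z, (0 <= P z)%E -> exists k, has_residue P z k
    & forall Q : place (const_ext F),
        (0 < Q (evalx ('X - (alpha i)%:P))%R)%E -> Q = P].
Proof.
have [u k uk _] := egcdnP m (lambda_gt0 i).
have {}uk : (u * lambda i = k * m + 1)%N.
  by move: uk; rewrite gcdnC; move: (cop i); rewrite /coprime => /eqP ->.
pose x_i := 'X - (alpha i)%:P : {poly K}.
pose o : {poly K} := \prod_(l | l != i) ('X - (alpha l)%:P) ^+ lambda l.
have fE : curve_poly = x_i ^+ lambda i * o by rewrite /curve_poly (bigD1 i).
have oi : o.[alpha i] != 0.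
  rewrite horner_prod; apply/prodf_neq0 => l li.
  rewrite horner_exp expf_neq0 // !hornerE subr_eq0.
  by apply: contra li => /eqP /alpha_inj ->.
have o0 : o != 0 by apply: contraNneq oi => ->; rewrite horner0.
have xi0 : x_i != 0 by rewrite polyXsubC_eq0.
have exi0 : evalx x_i != 0 by rewrite evalx_eq0.
pose w := y ^+ u / evalx x_i ^+ k.
pose h := x_i * o ^+ u.
have ym : y ^+ m = evalx x_i ^+ lambda i * evalx o.
  by rewrite curve_eq fE rmorphM rmorphXn.
have wh : w ^+ m = evalx h.
  rewrite /w /h exprMn exprAC ym exprMn exprVn -!exprM mulnC uk rmorphM rmorphXn.
  by rewrite exprD expr1; field; rewrite expf_neq0.
have h0 : h != 0 by rewrite mulf_neq0 ?expf_neq0.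
(* Modulo m, deg h = 1 + u deg o is u (lambda_i + deg o) = u lambda_0, and u is invertible because u
   lambda_i is 1. *)
have cop_h : coprime m (degp h).
  have deg_f : (degp curve_poly = \sum_l lambda l)%N by rewrite degp_prod_XsubC.
  move: cop0; rewrite -deg_f fE degpM ?expf_neq0 // degpX degp_XsubC mul1n => copf.
  rewrite degpM ?expf_neq0 // degpX degp_XsubC.
  rewrite /coprime -(gcdnMDl k) -/(coprime _ _).
  have -> : (k * m + (1 + degp o * u) = u * (lambda i + degp o))%N.
    by rewrite mulnDr uk; lia.
  rewrite coprimeMr copf andbT.
  have : coprime m (u * lambda i) by rewrite uk /coprime gcdnMDl gcdn1.
  by rewrite coprimeMr => /andP[].
(* From u lambda_i = k m + 1 one gets o^k y = w^lambda_i, so x and w generate F. *)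
have wy : cleared w y.
  exists (o ^+ k), ('X ^+ lambda i); rewrite expf_neq0 //; split=> //.
  rewrite [RHS]rmorphXn eval2X /w exprMn exprVn -!exprM uk mulnC exprD expr1.
  rewrite exprM ym exprMn rmorphXn -exprM.
  rewrite [(lambda i * k)%N]mulnC; field.
  by rewrite expf_neq0.
have w_free (P : {poly {poly K}}) : (size P <= m)%N -> eval2 w P = 0 -> P = 0.
  exact: (radical_free Qinf_x m_gt0 wh).
have oiu : (o ^+ u).[alpha i] != 0 by rewrite horner_exp expf_neq0.
have [P [Px _ P_res P_uniq]] :=
  radical_branch_point m_gt0 wh w_free (cleared_gen wy) erefl oiu.
exists P; split=> // Q Qx; apply: P_uniq => //.
(* Every place over alpha_i is a zero of w, so the residue condition in the uniqueness clause is
   automatic. *)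
rewrite has_residue0; apply: (place_root_gt0 m_gt0); rewrite wh rmorphM.
apply: placeM_gt0 => //.
exact/has_residue_ge0/(evalx_residue (c := alpha i)).
Qed.

Lemma evalx_regular (P : place (const_ext F)) p :
  (0 <= P (evalx 'X))%E -> (0 <= P (evalx p))%E.
Proof. by move=> x0; apply: (@place_evalx_ge0 _ _ _ 0); rewrite subr0. Qed.

Lemma y_regular (P : place (const_ext F)) : (0 <= P (evalx 'X))%E -> (0 <= P y)%E.
Proof.
move=> x0; apply: (place_root_ge0 m_gt0); rewrite curve_eq.
exact: evalx_regular.
Qed.

Lemma over_regular (P : place (const_ext F)) c :
  (0 < P (evalx ('X - c%:P))%R)%E -> (0 <= P (evalx 'X))%E.
Proof. by move=> xc; exact: has_residue_ge0 (evalx_residue _ xc). Qed.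

(** If no x - c vanished at P, all nonzero polynomials in x would be units there, as K is
    algebraically closed. Every z = A(y) / q would then be regular, against the existence of an
    element of order -1. *)
Lemma finite_place_center (P : place (const_ext F)) :
  (0 <= P (evalx 'X))%E -> exists c, (0 < P (evalx ('X - c%:P))%R)%E.
Proof.
move=> x0; apply: contrapT => no_c.
have xc c : P (evalx ('X - c%:P)) = 0%E.
  apply/eqP; rewrite eq_le leNgt; apply/andP; split.
    by apply/negP => xc; apply: no_c; exists c.
  rewrite rmorphB; apply: placeD_ge => //; rewrite placeN.
  exact: placeC_ge0.
have unit_p p : p != 0 -> P (evalx p) = 0%E.
  move=> p0; have [rs ->] := closed_field_poly_normal p.
  rewrite -mul_polyC rmorphM; apply: placeM_eq0.
    by rewrite evalxC place_val_const // lead_coef_eq0.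
  rewrite rmorph_prod; elim/big_ind: _ => [|z w|//].
    exact: place1.
  exact: placeM_eq0.
have reg z : (0 <= P z)%E.
  have [q [A [q0 qz]]] := cleared_y z.
  have -> : P z = P (eval2 y A) by rewrite -qz place_valM unit_p // add0e.
  rewrite eval2E horner_coef; apply: place_sum_ge => // i _.
  apply: placeM_ge0; last by apply: placeX_ge0; exact: y_regular.
  rewrite coef_map_id0 ?rmorph0 //.
  have [->|/unit_p -> //] := eqVneq A`_i 0; by rewrite rmorph0 place0.
have [z Pz] := place_val_normalized P.
have z0 : z != 0 by apply/eqP => z0; rewrite z0 place0 in Pz.
have := reg z^-1; rewrite place_fin ?invr_neq0 // ordvV //.
by rewrite /ordv Pz.
Qed.

(** * The integral basis and the places over each x = c *)

Definition floor_poly j : {poly K} :=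
  \prod_i ('X - (alpha i)%:P) ^+ (j * lambda i %/ m).

Definition rem_poly j : {poly K} :=
  \prod_i ('X - (alpha i)%:P) ^+ (j * lambda i %% m).

Definition int_basis (j : nat) : F := y ^+ j / evalx (floor_poly j).

Lemma int_basis_root j : int_basis j ^+ m = evalx (rem_poly j).
Proof.
rewrite exprMn exprAC curve_eq exprVn -!rmorphXn.
apply: (canLR (mulfK _)); first by rewrite evalx_eq0 expf_neq0 // XsubC_prod_neq0.
rewrite -rmorphM; congr (evalx _); rewrite /curve_poly /rem_poly /floor_poly.
rewrite -!prodrXl -big_split; apply: eq_bigr => i _ /=.
by rewrite -!exprM -exprD addnC [(lambda i * j)%N]mulnC -divn_eq.
Qed.

Lemma int_basis_neq0 j : int_basis j != 0.
Proof.
by rewrite mulf_neq0 ?expf_neq0 ?invr_neq0 ?y_neq0 // evalx_eq0 XsubC_prod_neq0.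
Qed.

Lemma int_basis_regular (P : place (const_ext F)) j :
  (0 <= P (evalx 'X))%E -> (0 <= P (int_basis j))%E.
Proof.
move=> x0; apply: (place_root_ge0 m_gt0); rewrite int_basis_root.
exact: evalx_regular.
Qed.

Lemma curve_poly_root c : curve_poly.[c] = 0 -> exists i, c = alpha i.
Proof.
move/eqP; rewrite horner_prod => /prodf_eq0[i _].
rewrite horner_exp expf_eq0 lambda_gt0 !hornerE subr_eq0 => /eqP.
by exists i.
Qed.

Lemma unramified_roots c : curve_poly.[c] != 0 ->
  exists bs : seq K, [/\ size bs = m, uniq bs,
    forall b, (b \in bs) = (b ^+ m == curve_poly.[c])
    & 'X^m - (curve_poly.[c])%:P = \prod_(b <- bs) ('X - b%:P)].
Proof.
move: (curve_poly.[c]) => d d0.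
have [bs] := closed_field_poly_normal ('X^m - d%:P).
rewrite (monicP (monicXnsubC d m_gt0)) scale1r => def_bs; exists bs; split=> //.
- by apply: succn_inj; rewrite -(size_prod_XsubC bs id) -def_bs size_XnsubC.
- rewrite -separable_prod_XsubC -def_bs unlock.
  (* Separability follows from -m (X^m - d) + X (m X^(m - 1)) = m d, a nonzero constant. *)
  apply/Bezout_coprimepP; exists (- m%:R%:P, 'X) => /=.
  rewrite derivB derivXn derivC subr0 -size_poly_eq1.
  have -> : - m%:R%:P * ('X^m - d%:P) + 'X * ('X^(m.-1) *+ m) = (m%:R * d)%:P.
    rewrite -[X in 'X * X]mulr_natr mulrA -exprS prednK // polyCM polyC_natr.
    ring.
  by rewrite size_polyC mulf_neq0.
- move=> b; rewrite -root_prod_XsubC -def_bs.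
  by rewrite /root !hornerE subr_eq0.
Qed.

(** Over alpha_i the single place is listed m times; over any other c there is one place of order 1
    for each of the m roots of b^m = f(c). *)
Lemma curve_places_over c : exists s : seq (place (const_ext F)),
  [/\ size s = m,
      forall P, P \in s -> (0 < P (evalx ('X - c%:P))%R)%E /\
        forall z, (0 <= P z)%E -> exists k, has_residue P z k
    & forall P : place (const_ext F), (0 < P (evalx ('X - c%:P))%R)%E ->
        (P (evalx ('X - c%:P))%R <= (count_mem P s)%:Z%:E)%E].
Proof.
have [/curve_poly_root[i ->]|fc] := eqVneq curve_poly.[c] 0.
  have [P [Px P_res P_uniq]] := curve_branch_place i.
  exists (nseq m P); split; first exact: size_nseq.
    by move=> Q /nseqP[-> _]; split=> //; rewrite Px lte_fin.
  by move=> Q /P_uniq ->; rewrite count_nseq /= eqxx mul1n Px.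
have [bs [sz_bs _ bsP def_bs]] := unramified_roots fc.
have : forall b, exists P : place (const_ext F), b \in bs ->
  [/\ P (evalx ('X - c%:P)) = 1%:E,
      forall z, (0 <= P z)%E -> exists k, has_residue P z k
    & forall Q : place (const_ext F),
        (0 < Q (evalx ('X - c%:P))%R)%E -> has_residue Q y b -> Q = P].
  move=> b; have [|] := boolP (b \in bs); last by exists Qinf.
  rewrite bsP => /eqP/esym fcb.
  have b0 : b != 0 by apply: contraNneq fc => b0; rewrite fcb b0 expr0n gtn_eqF.
  have [P [Px _ P_res P_uniq]] := curve_unramified_place fcb b0.
  by exists P.
move=> /choice[pl plP]; exists (map pl bs); split; first by rewrite size_map.
  by move=> P /mapP[b /plP[Px P_res _] ->]; rewrite Px; split.
move=> P xc.
(* Otherwise every factor of y^m - f(c) = prod_b (y - b) would be a unit at P, whereas f(x) - f(c)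
   vanishes there. *)
have [b b_bs yb] : exists2 b, b \in bs & has_residue P y b.
  apply: contrapT => no_b.
  have : P (y ^+ m - const_ext F curve_poly.[c]) = 0%E.
    have -> : y ^+ m - const_ext F curve_poly.[c] = \prod_(b <- bs) (y - const_ext F b).
      exact: rmorph_roots_prod def_bs.
    rewrite big_seq_cond; elim/big_ind: _ => [|z w|b].
    - exact: place1.
    - exact: placeM_eq0.
    rewrite andbT => b_bs; apply/eqP; rewrite eq_le leNgt; apply/andP; split.
      by apply/negP => yb; apply: no_b; exists b.
    apply: placeD_ge; first by apply: y_regular; exact: over_regular xc.
    by rewrite placeN placeC_ge0.
  apply/eqP; rewrite gt_eqF // curve_eq.
  exact: (evalx_residue curve_poly xc).
have [Px _ P_uniq] := plP _ b_bs; rewrite (P_uniq _ xc yb) Px lee_fin.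
by rewrite -[1]/(1%N%:Z) lez_nat -has_count has_pred1 map_f.
Qed.

Lemma ordv_branch_prod (P : place (const_ext F)) i (e : 'I_r -> nat) :
  P (evalx ('X - (alpha i)%:P)) = (m%:Z)%:E ->
  ordv P (evalx (\prod_l ('X - (alpha l)%:P) ^+ e l)) = (m * e i)%:Z.
Proof.
move=> Px.
have -> : \prod_l ('X - (alpha l)%:P) ^+ e l = ('X - (alpha i)%:P) ^+ e i *
            \prod_(l | l != i) ('X - (alpha l)%:P) ^+ e l by rewrite (bigD1 i).
rewrite [in LHS]rmorphM ordvM; last 2 first.
- by rewrite evalx_eq0 expf_neq0 ?polyXsubC_eq0.
- by rewrite evalx_eq0; apply/prodf_neq0 => l _; rewrite expf_neq0 ?polyXsubC_eq0.
rewrite [in LHS]rmorphXn ordvX ?evalx_eq0 ?polyXsubC_eq0 // {1}/ordv Px /=.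
suff -> : ordv P (evalx (\prod_(l | l != i) ('X - (alpha l)%:P) ^+ e l)) = 0.
  by rewrite addr0 -mulr_natr natz PoszM.
have xc : (0 < P (evalx ('X - (alpha i)%:P))%R)%E by rewrite Px lte_fin.
rewrite /ordv (has_residue_neq0 (evalx_residue _ xc)) //.
rewrite horner_prod; apply/prodf_neq0 => l li.
rewrite horner_exp expf_neq0 // !hornerE subr_eq0.
by apply: contra li => /eqP /alpha_inj ->.
Qed.

(* Over a branch point the orders of the basis elements are distinct and less than m;
   over any other point the residues are the values of a polynomial of degree less
   than m at the m roots of b^m = f(c). *)
Lemma int_basis_independent_at c (k : 'I_m -> K) :
  (forall P : place (const_ext F), (0 < P (evalx ('X - c%:P))%R)%E ->
     (P (evalx ('X - c%:P))%R <= P (\sum_j const_ext F (k j) * int_basis j)%R)%E) ->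
  forall j, k j = 0.
Proof.
move=> sum_ge j0; apply/eqP/negPn/negP => kj0; move: sum_ge.
have [/curve_poly_root[i ->]|fc] := eqVneq curve_poly.[c] 0 => sum_ge.
  have [P [Px _ _]] := curve_branch_place i.
  have := sum_ge P; rewrite Px lte_fin => /(_ m_gt0).
  pose f (j : 'I_m) := const_ext F (k j) * int_basis j.
  have f0 j : (f j != 0) = (k j != 0).
    by rewrite /f mulf_eq0 (negPf (int_basis_neq0 _)) orbF fmorph_eq0.
  (* The m-th power of e_j is [rem_poly j], in which x - alpha_i, of order m, has exponent j
     lambda_i mod m. *)
  have ordf j : k j != 0 -> ordv P (f j) = (j * lambda i %% m)%:Z.
    move=> kj; rewrite /f ordvM ?fmorph_eq0 ?int_basis_neq0 // ordvC // add0r.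
    have := ordvX P m (int_basis_neq0 j); rewrite int_basis_root.
    rewrite (@ordv_branch_prod P i) // => ordE.
    apply: (mulIf (_ : m%:Z != 0)); first by rewrite eqz_nat -lt0n.
    by rewrite -PoszM mulnC ordE -mulr_natr natz.
  have f_inj j j' : f j != 0 -> f j' != 0 -> P (f j) = P (f j') -> j = j'.
    move=> fj fj'; rewrite !place_fin // => -[].
    rewrite f0 in fj; rewrite f0 in fj'; rewrite !ordf // => -[] /eqP.
    move=> eq_mod; apply/val_inj/eqP; rewrite /=.
    have {eq_mod} : j = j' %[mod m].
      move: eq_mod; wlog le_jj' : j j' {fj fj'} / (j <= j')%N.
        move=> IH e; have [|/ltnW] := leqP j j'; move/IH; first exact.
        by rewrite eq_sym => /(_ e).
      rewrite eq_sym eqn_mod_dvd ?leq_mul2r ?le_jj' ?orbT // -mulnBl.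
      by rewrite Gauss_dvdl // -eqn_mod_dvd // => /eqP.
    by rewrite !modn_small // => ->.
  have [|j [fj -> _]] := place_sum_distinct f_inj; first by exists j0; rewrite f0.
  rewrite place_fin // lee_fin; rewrite f0 in fj.
  by rewrite ordf // lez_nat leqNgt ltn_mod m_gt0.
have [bs [sz_bs bs_uniq bsP _]] := unramified_roots fc.
(* The denominator of e_j is a unit over c, and its value there is absorbed into the coefficient. *)
pose k' (j : 'I_m) := k j / (floor_poly j).[c].
have fl0 j : (floor_poly j).[c] != 0.
  rewrite horner_prod; apply/prodf_neq0 => i _.
  rewrite horner_exp expf_neq0 // !hornerE subr_eq0.
  apply: contraNneq fc => ->; rewrite horner_prod (bigD1 i) //=.
  by rewrite horner_exp !hornerE subrr expr0n gtn_eqF // mul0r.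
pose p : {poly K} := \poly_(j < m) (if insub j is Some j then k' j else 0).
have p0 : p = 0.
  apply: (@roots_geq_poly_eq0 _ _ bs) => //; last by rewrite sz_bs size_poly.
  apply/allP => b; rewrite bsP => /eqP/esym fcb.
  have b0 : b != 0 by apply: contraNneq fc => b0; rewrite fcb b0 expr0n gtn_eqF.
  have [P [Px Py _ _]] := curve_unramified_place fcb b0.
  have xc : (0 < P (evalx ('X - c%:P))%R)%E by rewrite Px lte_fin.
  have /(lt_le_trans xc) := sum_ge P xc; rewrite -has_residue0 => res0.
  rewrite /root horner_poly; apply/eqP/(has_residue_inj _ res0).
  apply: has_residue_sum => j _; rewrite valK /k' -mulrA [_^-1 * _]mulrC.
  apply: has_residueM; first exact: has_residueC.
  apply: has_residueM; first exact: has_residueX.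
  exact: has_residueV (evalx_residue _ xc) (fl0 j).
have := congr1 (fun q : {poly K} => q`_j0) p0; rewrite coef0 coef_poly ltn_ord valK.
by move/eqP; rewrite mulf_eq0 invr_eq0 (negPf kj0) (negPf (fl0 j0)).
Qed.

Lemma int_basis_gen z :
  exists q (a : 'I_m -> {poly K}),
    q != 0 /\ evalx q * z = \sum_j evalx (a j) * int_basis j.
Proof.
have [q [P [q0 qz]]] := cleared_y z.
have mon_D := monicXnsubC curve_poly m_gt0.
set D := 'X^m - curve_poly%:P in mon_D.
pose R := Pdiv.Ring.rmodp P D.
have szR : (size R <= m)%N.
  have := Pdiv.Ring.ltn_rmodpN0 P (monic_neq0 mon_D).
  by rewrite size_XnsubC.
exists q, (fun j => R`_j * floor_poly j); split=> //.
rewrite qz (Pdiv.RingMonic.rdivp_eq mon_D P) -/R rmorphD rmorphM.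
have -> : eval2 y D = 0 by rewrite rmorphB rmorphXn eval2X eval2C curve_eq subrr.
rewrite mulr0 add0r eval2E (@horner_coef_wide _ m); last first.
  exact: leq_trans (size_poly _ _) szR.
apply: eq_bigr => j _; rewrite coef_map_id0 ?rmorph0 // rmorphM -mulrA.
by congr (_ * _); rewrite /int_basis mulrCA divff ?mulr1 // evalx_eq0 XsubC_prod_neq0.
Qed.

(** Induction on the degree of the denominator q. If q(c) = 0, the sum of the a_j(c) e_j is
    divisible by x - c at every place over c, so all a_j(c) vanish by independence and a factor x -
    c cancels. *)
Lemma integral_basis z :
  (forall P : place (const_ext F), (0 <= P (evalx 'X))%E -> (0 <= P z)%E) ->
  exists a : 'I_m -> {poly K}, z = \sum_j evalx (a j) * int_basis j.
Proof.
have [q [a [q0 qz]]] := int_basis_gen z; move: q0 qz.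
have [n] := ubnP (size q); elim: n q a => // n IH q a szq q0 qz z_reg.
have [/size_poly1P[k k0 q_k]|/closed_rootP[c]] := boolP (size q == 1%N).
  exists (fun j => k^-1%:P * a j).
  under eq_bigr do rewrite rmorphM -mulrA.
  rewrite -mulr_sumr -qz q_k mulrA -rmorphM -polyCM mulVf //.
  by rewrite rmorph1 mul1r.
move/factor_theorem=> [q' def_q].
have q'0 : q' != 0 by apply: contraNneq q0; rewrite def_q => ->; rewrite mul0r.
have /choice[b def_b] : forall j, exists b, a j = b * ('X - c%:P) + (a j).[c]%:P.
  move=> j; have /factor_theorem[b ab] : root (a j - (a j).[c]%:P) c.
    by rewrite /root hornerD hornerN hornerC subrr.
  by exists b; rewrite -ab subrK.
pose s := \sum_j const_ext F (a j).[c] * int_basis j.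
have sum_a : \sum_j evalx (a j) * int_basis j
             = evalx ('X - c%:P) * (\sum_j evalx (b j) * int_basis j) + s.
  rewrite mulr_sumr -big_split; apply: eq_bigr => j _.
  by rewrite {1}(def_b j) rmorphD rmorphM evalxC mulrDl mulrA [_ * evalx (b j)]mulrC.
have /int_basis_independent_at ac0 : forall P : place (const_ext F),
    (0 < P (evalx ('X - c%:P))%R)%E -> (P (evalx ('X - c%:P))%R <= P s)%E.
  move=> P xc; have x0 := over_regular xc.
  have -> : s = evalx ('X - c%:P) * (evalx q' * z - \sum_j evalx (b j) * int_basis j).
    rewrite mulrBr mulrA -rmorphM [_ * q']mulrC -def_q qz sum_a; ring.
  rewrite place_valM; apply: leeDl; apply: placeD_ge.
    by apply: placeM_ge0; [exact: evalx_regular|exact: z_reg].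
  rewrite placeN; apply: place_sum_ge => // j _.
  by apply: placeM_ge0; [exact: evalx_regular|exact: int_basis_regular].
have s0 : s = 0 by apply: big1 => j _; rewrite ac0 rmorph0 mul0r.
apply: (IH q' b) => //.
  rewrite def_q size_Mmonic ?monicXsubC // size_XsubC addn2 /= in szq.
  by rewrite -ltnS.
apply: (mulfI (_ : evalx ('X - c%:P) != 0)).
  by rewrite evalx_eq0 polyXsubC_eq0.
by rewrite mulrA -rmorphM [_ * q']mulrC -def_q qz sum_a s0 addr0.
Qed.

(** * Pole orders at infinity and the Weierstrass semigroup *)

Definition apery (j : nat) : nat := (\sum_i (j * lambda i %% m))%N.

Lemma apery_mod j : apery j = (j * \sum_i lambda i)%N %[mod m].
Proof. by rewrite /apery modn_summ big_distrr. Qed.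

Lemma apery_inj (i j : 'I_m) : apery i = apery j %[mod m] -> i = j.
Proof.
rewrite !apery_mod; exact: mulm_inj.
Qed.

Lemma degp_rem_poly j : degp (rem_poly j) = apery j.
Proof. exact: degp_prod_XsubC. Qed.

Lemma apery_max j : (apery j <= r * m.-1)%N.
Proof.
apply: (@leq_trans (\sum_(i < r) m.-1)%N); last by rewrite sum_nat_const card_ord.
by apply: leq_sum => i _; rewrite -ltnS prednK // ltn_mod.
Qed.

Section Infinity.
Variable Q : place (const_ext F).
Hypothesis Qx : (Q (evalx 'X) < 0)%E.

Let rem_poly_inj (i j : 'I_m) :
  degp (rem_poly i) = degp (rem_poly j) %[mod m] -> i = j.
Proof. by rewrite !degp_rem_poly; exact: apery_inj. Qed.

Let nz_coef (I : finType) (a : I -> {poly K}) (b : I -> F) :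
  \sum_j evalx (a j) * b j != 0 -> exists j, a j != 0.
Proof.
move=> z0; apply: contrapT => a0; case/eqP: z0; apply: big1 => j _.
have [->|aj] := eqVneq (a j) 0; first by rewrite rmorph0 mul0r.
by case: a0; exists j.
Qed.

(** From m v(y) = v(x) lambda_0, m divides v(x). Conversely m v(z) is a multiple of v(x) for every
    nonzero z, and some z has order 1. The place is an arbitrary pole of x, as [Qinf_unique]
    requires. *)
Lemma ordv_inf_X : ordv Q (evalx 'X) = - m%:Z.
Proof.
have V0 := ordv_X_lt0 Qx; set V := ordv Q _ in V0 *.
have m_dvd_V : (m %| `|V|)%N.
  have : ordv Q y *+ m = V * (\sum_i lambda i)%:Z.
    rewrite -ordvX ?y_neq0 // curve_eq ordv_evalx_inf ?XsubC_prod_neq0 //.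
    by rewrite degp_prod_XsubC.
  move/(congr1 absz); rewrite -mulr_natr natz !abszM => e.
  by rewrite -(Gauss_dvdl _ cop0) -e dvdn_mull.
have V_dvd_m : (`|V| %| m)%N.
  have [z Qz] := place_val_normalized Q.
  have z0 : z != 0 by apply/eqP => z0; rewrite z0 place0 in Qz.
  have [q [a [q0 qz]]] := int_basis_gen z.
  have qz0 : evalx q * z != 0 by rewrite mulf_neq0 ?evalx_eq0.
  have [|j [_ _ + _]] := radical_sum_inf Qx m_gt0 int_basis_root
    (fun j => XsubC_prod_neq0 _) rem_poly_inj (a := a).
    by apply: (nz_coef (b := fun j : 'I_m => int_basis j)); rewrite -qz.
  rewrite -qz ordvM ?evalx_eq0 // ordv_evalx_inf // -/V {1}/ordv Qz /=.
  set N := (_ + _)%N => e.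
  have : m%:Z = V * (N%:Z - (degp q * m)%N%:Z).
    by rewrite mulrBr -e -mulr_natr natz PoszM; ring.
  by move/(congr1 absz); rewrite abszM /= => ->; rewrite dvdn_mulr.
have : `|V|%N = m by apply/eqP; rewrite eqn_dvd V_dvd_m.
by move: V0; lia.
Qed.

Lemma ordv_inf_int_basis j : ordv Q (int_basis j) = - (apery j)%:Z.
Proof.
have := ordvX Q m (int_basis_neq0 j); rewrite int_basis_root ordv_evalx_inf //.
  rewrite ordv_inf_X degp_rem_poly -mulr_natr natz => e.
  by apply: (mulIf (_ : m%:Z != 0)); [rewrite eqz_nat -lt0n|rewrite -e; ring].
exact: XsubC_prod_neq0.
Qed.

Lemma ordv_inf_sum (a : 'I_m -> {poly K}) :
  let z := \sum_j evalx (a j) * int_basis j in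
  let N j := (m * degp (a j) + apery j)%N in
  z != 0 ->
  exists j, [/\ a j != 0, ordv Q z = - (N j)%:Z
              & forall i, a i != 0 -> (N i <= N j)%N].
Proof.
move=> z N z0; have [|j [aj _ e N_max]] := radical_sum_inf Qx m_gt0 int_basis_root
  (fun j => XsubC_prod_neq0 _) rem_poly_inj (a := a); first exact: nz_coef z0.
exists j; split=> //; last by move=> i /N_max; rewrite !degp_rem_poly.
apply: (mulIf (_ : m%:Z != 0)); first by rewrite eqz_nat -lt0n.
by rewrite -natz mulr_natr e ordv_inf_X degp_rem_poly natz -/(N j); ring.
Qed.

End Infinity.

(** The order of sum_j a_j e_j at a pole of x depends only on which a_j are nonzero and on their
    degrees, so all poles of x define the same valuation. *)
Lemma Qinf_unique (Q : place (const_ext F)) : (Q (evalx 'X) < 0)%E -> Q = Qinf.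
Proof.
move=> Qx; apply: place_ext => z z0; rewrite !place_fin //; congr (_%:E).
have [q [a [q0 qz]]] := int_basis_gen z.
have qz0 : evalx q * z != 0 by rewrite mulf_neq0 ?evalx_eq0.
have eq0 : evalx q != 0 by rewrite evalx_eq0.
have : ordv Q (evalx q * z) = ordv Qinf (evalx q * z).
  rewrite {}qz in qz0 *.
  have [j [aj -> j_max]] := ordv_inf_sum Qx qz0.
  have [i [ai -> i_max]] := ordv_inf_sum Qinf_x qz0.
  congr (- (Posz _)); apply/eqP; rewrite eqn_leq.
  by apply/andP; split; [exact: i_max|exact: j_max].
rewrite (ordvM Q eq0 z0) (ordvM Qinf eq0 z0) (ordv_evalx_inf Qx q0).
by rewrite (ordv_evalx_inf Qinf_x q0) (ordv_inf_X Qx) (ordv_inf_X Qinf_x) => /addrI.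
Qed.

Lemma finite_place (P : place (const_ext F)) :
  P != Qinf -> (0 <= P (evalx 'X))%E.
Proof. by move=> PQ; rewrite leNgt; apply: contra PQ => /Qinf_unique ->. Qed.

Lemma finite_placeP (P : place (const_ext F)) :
  (0 <= P (evalx 'X))%E -> P != Qinf.
Proof. by apply: contraTneq => ->; rewrite -ltNge. Qed.

Lemma weierstrass_semigroupE :
  weierstrass_semigroup Qinf =
    [set s | exists j : 'I_m, (apery j <= s)%N /\ s = apery j %[mod m]]%classic.
Proof.
apply/seteqP; split=> s /=.
  move=> [z z_pole].
  have [z_eq0|z0] := eqVneq z 0.
    (* The zero function counts as having no pole, which yields s = 0, the class of j = 0. *)
    have := z_pole Qinf; rewrite coeffU eqxx mulr1 z_eq0 place0 /= maxeNy => -[->].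
    exists (Ordinal m_gt0); rewrite /apery big1 // => i _.
    by rewrite mul0n mod0n.
  have [a def_z] : exists a : 'I_m -> {poly K}, z = \sum_j evalx (a j) * int_basis j.
    apply: integral_basis => P /finite_placeP PQ.
    have := z_pole P; rewrite coeffU eq_sym (negPf PQ) mulr0 => /esym/eqP.
    by rewrite eq_maxl oppe_le0.
  have z0' := z0; rewrite def_z in z0'.
  have [j [aj ord_z _]] := ordv_inf_sum Qinf_x z0'; exists j.
  have := z_pole Qinf; rewrite coeffU eqxx mulr1 place_fin // def_z ord_z.
  rewrite -EFinN opprK max_r ?lee_fin // => -[->].
  by rewrite leq_addl mulnC modnMDl.
move=> [j [le_j eq_j]].
have [t def_s] : exists t, s = (m * t + apery j)%N.
  move/eqP: eq_j; rewrite eqn_mod_dvd // => /dvdnP[t def_t].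
  by exists t; rewrite mulnC -def_t subnK.
have X0 : evalx 'X != 0 by rewrite evalx_eq0 polyX_eq0.
have z0 : evalx 'X ^+ t * int_basis j != 0.
  by rewrite mulf_neq0 ?expf_neq0 ?int_basis_neq0.
exists (evalx 'X ^+ t * int_basis j) => P; rewrite coeffU.
have [<-|QP] := eqVneq Qinf P.
  rewrite mulr1 place_fin // ordvM ?expf_neq0 ?int_basis_neq0 // ordvX //.
  rewrite ordv_inf_X // ordv_inf_int_basis // -EFinN max_r.
    by congr (_%:E); rewrite def_s -mulr_natr natz; lia.
  by rewrite lee_fin -mulr_natr natz; lia.
have x0 : (0 <= P (evalx 'X))%E by apply: finite_place; rewrite eq_sym.
rewrite mulr0; apply/esym/eqP; rewrite eq_maxl oppe_le0.
by apply: placeM_ge0; [exact: placeX_ge0|exact: int_basis_regular].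
Qed.

Lemma curve_genus : is_genus (const_ext F) (gap_count m apery).
Proof.
apply: (@genus_gap_count K F Qinf m int_basis apery) => //.
- exact: apery_inj.
- exact: finite_place.
- by move=> P j /finite_place; exact: int_basis_regular.
- exact: ordv_inf_X.
- exact: ordv_inf_int_basis.
- exact: int_basis_neq0.
- by move=> z z_reg; apply: integral_basis => P /finite_placeP; exact: z_reg.
- by move=> a; exact: ordv_inf_sum.
- by move=> P /finite_place/finite_place_center.
- exact: curve_places_over.
Qed.

(** For fixed i, j lambda_i mod m permutes the residues because gcd(m, lambda_i) = 1. So the d_j sum
    to r m (m - 1) / 2, and [gap_countE] applies. *)
Lemma genus_double : (2 * gap_count m apery = r.-1 * m.-1)%N.
Proof.
have sum_j (n : nat) : (2 * \sum_(j < n) j = n * n.-1)%N.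
  elim: n => [|n IH]; first by rewrite big_ord0.
  by rewrite big_ord_recr /= mulnDr IH; case: n {IH} => // n; lia.
have := gap_countE m_gt0 apery_inj.
have -> : (\sum_(j < m) apery j = r * \sum_(j < m) j)%N.
  rewrite /apery exchange_big (eq_bigr (fun=> \sum_(j < m) j)%N) => [|i _].
    by rewrite sum_nat_const card_ord.
  by rewrite (@sum_residues m (fun j => j * lambda i)%N _ _ id) // => j j' /mulm_inj ->.
have := sum_j m; move: (\sum_(j < m) j)%N => S.
move: (gap_count _ _) m_gt0 m_gt1 r_gt0 => g; case: (m) (r) => // m' [] // r' _ _ _ /=.
by nia.
Qed.

(** * Equality of the lambda_i, the semigroup <m, r>, and symmetry *)

Lemma lambda_eq_mod (j c : nat) : coprime m c ->
  (forall i, j * lambda i = c %[mod m]) -> forall i i', lambda i = lambda i'.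
Proof.
move=> cop_c jl i i'.
(* Invertibility of j modulo m is inherited from c, which is 1 or m - 1 in the two applications. *)
have cop_j : coprime m j.
  have : coprime m (j * lambda i) by rewrite -coprime_modr jl coprime_modr.
  by rewrite coprimeMr => /andP[].
have := jl i; rewrite -(jl i') ![(j * _)%N]mulnC => e.
by have [] := @mulm_inj m j (Ordinal (lambda_lt i)) (Ordinal (lambda_lt i')) cop_j e.
Qed.

Lemma generated_semigroup2 (a b : nat) n :
  generated_semigroup [:: a; b] n <-> exists s t, n = (s * a + t * b)%N.
Proof.
split=> [[t ->]|[s [t ->]]].
  exists (t ord0), (t (fintype.lift ord0 ord0)).
  by rewrite big_ord_recl big_ord1.
exists (fun i => if val i == 0%N then s else t).
by rewrite big_ord_recl big_ord1.
Qed.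

Lemma apery_const j : (forall i i', lambda i = lambda i') ->
  forall i, apery j = (r * (j * lambda i %% m))%N.
Proof.
move=> lam i; rewrite /apery (eq_bigr (fun=> j * lambda i %% m)%N) => [|i' _].
  by rewrite sum_nat_const card_ord.
by rewrite (lam i' i).
Qed.

Lemma semigroup_of_lambda : (forall i i', lambda i = lambda i') ->
  weierstrass_semigroup Qinf = generated_semigroup [:: m; r].
Proof.
move=> lam; rewrite weierstrass_semigroupE; pose i0 := Ordinal r_gt0.
apply/seteqP; split=> s /=; rewrite generated_semigroup2.
  move=> [j [le_j /eqP]]; rewrite eqn_mod_dvd // => /dvdnP[t def_t].
  exists t, (j * lambda i0 %% m)%N.
  by rewrite -def_t [X in (_ + X)%N]mulnC -(apery_const _ lam) subnK.
move=> [a [b ->]].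
have [|j jb] := @residue_surj m (fun j => j * lambda i0)%N m_gt0 _ b.
  by move=> i j; apply: mulm_inj.
exists j; rewrite (apery_const _ lam i0) jb; split.
  by rewrite mulnC (leq_trans _ (leq_addl _ _)) // leq_mul2r leq_mod orbT.
by rewrite modnMDl mulnC modnMmr.
Qed.

Lemma lambda_of_semigroup :
  weierstrass_semigroup Qinf = generated_semigroup [:: m; r] ->
  forall i i', lambda i = lambda i'.
Proof.
rewrite weierstrass_semigroupE => H_mr.
have [j [le_j eq_j]] : exists j : 'I_m, (apery j <= r)%N /\ r = apery j %[mod m].
  have : generated_semigroup [:: m; r] r.
    by rewrite generated_semigroup2; exists 0%N, 1%N; rewrite mul1n.
  by rewrite -H_mr.
(* For j = 0, m would divide r and hence all of <m, r>; but some d_k is 1 modulo m. *)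
have j_gt0 : (0 < j)%N.
  rewrite lt0n; apply/eqP => j0.
  have m_r : (m %| r)%N.
    by rewrite /dvdn eq_j j0 /apery big1 ?mod0n // => i _; rewrite mul0n mod0n.
  have [k k1] := residue_surj m_gt0 apery_inj 1.
  have : generated_semigroup [:: m; r] (apery k) by rewrite -H_mr; exists k.
  rewrite generated_semigroup2 => -[a [b e]].
  have : (m %| apery k)%N by rewrite e dvdn_add // dvdn_mull.
  by rewrite /dvdn k1 modn_small.
apply: (@lambda_eq_mod j 1); first exact: coprimen1.
have ge1 i : (0 < j * lambda i %% m)%N.
  rewrite lt0n; apply/negP => /eqP/eqP; rewrite -/(dvdn _ _) Gauss_dvdl //.
  by move=> /dvdn_leq; rewrite j_gt0 leqNgt ltn_ord => /(_ isT).
move=> i; rewrite [RHS]modn_small //; apply/eqP; rewrite eqn_leq ge1 andbT.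
move: le_j; rewrite /apery (bigD1 i) //= => le_j.
have : (r.-1 <= \sum_(i' < r | i' != i) j * lambda i' %% m)%N.
  apply: (@leq_trans (\sum_(i' < r | i' != i) 1)%N).
    by rewrite sum1_card cardC1 card_ord.
  by apply: leq_sum => i' _; exact: ge1.
move: le_j r_gt0; move: (j * lambda i %% m)%N (\sum_(_ | _) _)%N => A S.
by case: (r) => //; lia.
Qed.

(** A gap lies below the least element of H(Qinf) in its class, hence at least m below it. *)
Lemma gap_boundP f : ~ weierstrass_semigroup Qinf f ->
  exists j : 'I_m, (f + m <= apery j)%N /\ apery j = f %[mod m].
Proof.
rewrite weierstrass_semigroupE => fH; have [j ej] := residue_surj m_gt0 apery_inj f.
exists j; split=> //.
have lt_f : (f < apery j)%N.
  by rewrite ltnNge; apply/negP => le_f; apply: fH; exists j.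
move/eqP: ej; rewrite (eqn_mod_dvd _ (ltnW lt_f)) => /dvdn_leq.
by rewrite subn_gt0 => /(_ lt_f); lia.
Qed.

Lemma lambda_of_symmetric : symmetric_semigroup Qinf ->
  forall i i', lambda i = lambda i'.
Proof.
move=> [g [f [g_genus [fH _] def_f]]].
(* [is_genus] describes an attained maximum, so it determines g. *)
have g_eq : g = gap_count m apery.
  have [[D1 [l1 [dim1 e1]]] le1] := g_genus.
  have [[D2 [l2 [dim2 e2]]] le2] := curve_genus.
  apply/eqP; rewrite eqn_leq -!lez_nat -{1}e1 -{2}e2.
  by rewrite (le1 _ _ dim2) (le2 _ _ dim1).
have def_f' : (f.+1 = r.-1 * m.-1)%N by rewrite -genus_double -g_eq; lia.
have [j [le_j _]] := gap_boundP fH.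
(* f + m = (r - 1)(m - 1) - 1 + m = r (m - 1). *)
have apery_j : (r * m.-1 <= apery j)%N.
  apply: leq_trans le_j; rewrite -{1}(prednK r_gt0) mulSn -def_f'.
  by have := m_gt0; lia.
apply: (@lambda_eq_mod j m.-1); first exact: coprimenP.
move=> i; rewrite [RHS]modn_small ?prednK //.
have term_le i' : (j * lambda i' %% m <= m.-1)%N by rewrite -ltnS prednK ?ltn_mod.
apply/eqP; rewrite eqn_leq term_le /=.
move: apery_j; rewrite /apery (bigD1 i) //= => ge.
have : (\sum_(i' < r | i' != i) j * lambda i' %% m <= r.-1 * m.-1)%N.
  apply: (@leq_trans (\sum_(i' < r | i' != i) m.-1)%N).
    by apply: leq_sum => i' _; exact: term_le.
  by rewrite sum_nat_const cardC1 card_ord.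
move: ge r_gt0; move: (j * lambda i %% m)%N (\sum_(_ | _) _)%N => A S.
by case: (r) => // r' /=; rewrite mulSn; lia.
Qed.

Lemma symmetric_of_lambda : (1 < r)%N -> (forall i i', lambda i = lambda i') ->
  symmetric_semigroup Qinf.
Proof.
move=> r_gt1 lam; pose i0 := Ordinal r_gt0.
(* With r > 1 the number (r - 1)(m - 1) - 1 is a genuine predecessor. *)
have gap_gt0 : (0 < r.-1 * m.-1)%N by rewrite muln_gt0; have := m_gt1; lia.
exists (gap_count m apery), (r.-1 * m.-1).-1; split.
- exact: curve_genus.
- split.
    rewrite weierstrass_semigroupE => -[j [le_j eq_j]].
    have cop_r : coprime m r.
      move: cop0; rewrite (eq_bigr (fun=> lambda i0)) => [|i _]; last exact: lam.
      by rewrite sum_nat_const card_ord coprimeMr => /andP[].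
    move: le_j eq_j; rewrite (apery_const _ lam i0).
    set k := (j * lambda i0 %% m)%N => le_k eq_k.
    have k_lt : (k < m)%N by rewrite ltn_mod.
    (* Since f + r = (r - 1) m, a representation of f gives m | r (k + 1), so k = m - 1; but r (m -
       1) exceeds f. *)
    have : (r * k + r = 0 %[mod m])%N.
      rewrite -modnDml -eq_k modnDml.
      have -> : ((r.-1 * m.-1).-1 + r = r.-1 * m)%N.
        move: gap_gt0 r_gt0 m_gt0; case: (r) (m) => // r' [] // m' /=.
        by rewrite mulnS; move: (r' * m')%N; lia.
      by rewrite modnMl mod0n.
    move/eqP; rewrite addnC -mulnS mod0n -/(dvdn _ _) Gauss_dvdr // => /dvdn_leq.
    rewrite ltnS => /(_ isT) le_m.
    have k_eq : k = m.-1 by lia.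
    move: le_k; rewrite k_eq; move: gap_gt0 r_gt0 m_gt0.
    by case: (r) (m) => // r' [] // m' /=; rewrite mulSn; move: (r' * m')%N; lia.
  move=> s /gap_boundP[j [le_s _]].
  have := leq_trans le_s (apery_max j); move: gap_gt0 r_gt0 m_gt0.
  by case: (r) (m) => // r' [] // m' /=; rewrite mulSn; move: (r' * m')%N; lia.
- by have := genus_double; lia.
Qed.

End Curve.

(** * The pole of x at Qinf, and the equivalences for the given place *)

Lemma place_inv_gt0 (K L : fieldType) (iota : {rmorphism K -> L}) (P : place iota) z :
  z != 0 -> (0 < P z^-1%R)%E = (P z < 0)%E.
Proof.
move=> z0; rewrite (place_fin P (invr_neq0 z0)) (place_fin P z0) ordvV //.
by rewrite !lte_fin oppr_gt0.
Qed.

Lemma place_in_alg_inv_gt0 (K R : fieldType) (A : fieldExtType R)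
    (iota : {rmorphism K -> A}) (P : place iota) (u : R) :
  u != 0 -> (0 < P (u^-1%:A)%R)%E = (P (u%:A)%R < 0)%E.
Proof.
move=> u0; have -> : u^-1%:A = u%:A^-1 :> A by exact: (fmorphV (in_alg A)).
by rewrite place_inv_gt0 // scaler_eq0 oner_eq0 orbF.
Qed.

Theorem theorem2 (p e : nat) (hp : prime p) (he : (0 < e)%N)
    (Fq : finFieldType) (hq : #|Fq| = (p ^ e)%N)
    (K : closedFieldType) (j : {rmorphism Fq -> K})
    (hK : forall c : K, algebraicOver j c)
    (m r : nat) (hm : (2 <= m)%N) (hr : (2 <= r)%N) (hpm : ~~ (p %| m)%N)
    (alpha : 'I_r -> K) (halpha : injective alpha)
    (lambda : 'I_r -> nat) (hlambda : forall i, (1 <= lambda i < m)%N)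
    (hlambda0 : coprime m (\sum_i lambda i)%N)
    (F : fieldExtType (ratfun K)) (y : F)
    (hF : curve_function_field m alpha lambda y)
    (Pinf : place (const_ratfun K)) (hPinf : (Pinf (ratfunX K) < 0)%E)
    (Qinf : place (const_ext F)) (hQinf : lies_over Qinf Pinf)
    (hcop : forall i, coprime m (lambda i)) :
  (weierstrass_semigroup Qinf = generated_semigroup [:: m; r] <->
   forall i i' : 'I_r, lambda i = lambda i') /\
  ((r < m)%N ->
   (weierstrass_semigroup Qinf = generated_semigroup [:: m; r] <->
    symmetric_semigroup Qinf) /\
   ((forall i i' : 'I_r, lambda i = lambda i') <->
    symmetric_semigroup Qinf)).
Proof.
have m_gt0 : (0 < m)%N by exact: ltnW.
have r_gt0 : (0 < r)%N by exact: ltnW.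
have mK : m%:R != 0 :> K.
  have pK : p \in [pchar K] by apply: (rmorph_pchar j); exact: card_finPcharP hq hp.
  by rewrite -(dvdn_pcharf pK).
have lambda_gt0 i : (0 < lambda i)%N by have /andP[] := hlambda i.
have lambda_lt i : (lambda i < m)%N by have /andP[] := hlambda i.
have Qx : (Qinf (evalx F 'X) < 0)%E.
  have X0 : ratfunX K != 0 by rewrite tofrac_eq0 polyX_eq0.
  change (Qinf (ratfunX K)%:A%R < 0)%E.
  (* [lies_over] transports positive values only, so it is applied to 1/x. *)
  rewrite -(place_in_alg_inv_gt0 Qinf X0); apply: hQinf.
  by rewrite place_inv_gt0.
have iff1 : weierstrass_semigroup Qinf = generated_semigroup [:: m; r] <->
    forall i i' : 'I_r, lambda i = lambda i'.
  split; first exact: (lambda_of_semigroup hm mK halpha lambda_gt0 lambda_lt r_gt0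
                         hlambda0 hcop hF Qx).
  exact: (semigroup_of_lambda hm mK halpha lambda_gt0 r_gt0 hlambda0 hcop hF Qx).
have iff2 : (forall i i' : 'I_r, lambda i = lambda i') <-> symmetric_semigroup Qinf.
  split; first exact: (symmetric_of_lambda hm mK halpha lambda_gt0 r_gt0 hlambda0 hcop hF
                         Qx hr).
  exact: (lambda_of_symmetric hm mK halpha lambda_gt0 lambda_lt r_gt0
            hlambda0 hcop hF Qx).
by split=> // _; split=> //; rewrite iff1.
Qed.
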